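(* Let $X$ be a complex manifold of dimension $n$ with an exhaustive open covering $\{X_j\}_{j\in\mathbb{N}}$, and let $L$ be a holomorphic line bundle on $X$ with a singular Hermitian metric $h=h_0e^{-2\varphi}$, where $h_0$ is smooth and $\varphi$ is quasi-plurisubharmonic. Let $Z_j\subset X_j$ ($j\in\mathbb{N}$) be the analytic sets arising as singular loci of the compatible Demailly-type approximations of $\varphi$ on the $X_j$, as described in the context. Then $$\bigcup_{m\in\mathbb{N}}V(\mathscr{I}(h^m))=\{x\in X\mid\nu(\varphi,x)>0\}=\bigcup_{j\in\mathbb{N}}Z_j.$$
   Context: An exhaustive open covering of $X$ is a sequence of open subsets with $X_j\Subset X_{j+1}$ and $\bigcup_jX_j=X$. A function is quasi-plurisubharmonic if locally it is the sum of a plurisubharmonic and a smooth function. $\nu(\varphi,x)$ is the Lelong number of $\varphi$ at $x$. $\mathscr{I}(h^m)=\mathscr{I}(m\varphi)$ is the multiplier ideal sheaf of germs $f$ with $|f|^2e^{-2m\varphi}$ locally integrable, and $V(\mathscr{I})$ is the zero set of an ideal sheaf $\mathscr{I}$. Compatible Demailly-type approximations: for each $j$ there are positive integers $\nu_j$ and $m_j$, with $\nu_j$ increasing in $j$ and $m_j\to+\infty$, and a quasi-plurisubharmonic function $\varphi_j$ on $X_j$ such that (1) $\varphi_j$ has algebraic singularities: locally $\varphi_j=\frac{1+2^{-\nu_j}}{2m_j}\log\sum_{k}|\sigma_{j,k}|^2+(\text{smooth})$, where $\{\sigma_{j,k}\}_k$ is an orthonormal basis of the Hilbert space of holomorphic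 functions $f$ on a coordinate ball with $\int|f|^2e^{-2m_j(\varphi+a|z|^2)}d\lambda<\infty$ for some real constant $a$; (2) $Z_j$ is the set of logarithmic poles of $\varphi_j$, locally $Z_j=\bigcap_k\sigma_{j,k}^{-1}(0)$, an analytic subset of $X_j$; $\varphi_j$ is smooth on $X_j\setminus Z_j$; and $Z_j\subseteq Z_{j+1}\cap X_j$ for every $j$; (3) $\nu(\varphi,x)-\frac{n}{m_j}\le\nu\big(\frac{\varphi_j}{1+2^{-\nu_j}},x\big)\le\nu(\varphi,x)$ for every $x\in X_j$. *)

(* Defs.v *)
From HB Require Import structures.
From mathcomp Require Import all_boot all_order all_algebra.
From mathcomp Require Import all_classical all_reals all_analysis.
From mathcomp Require Import complex.

Set Implicit Arguments.
Unset Strict Implicit.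
Unset Printing Implicit Defensive.

Import Order.TTheory GRing.Theory Num.Theory.
Import numFieldNormedType.Exports.

Local Open Scope classical_set_scope.
Local Open Scope ring_scope.
Local Open Scope complex_scope.

(* R[i] as a normed space over itself: [differentiable] on 'rV[R[i]]_n is then
   complex (Frechet) differentiability. *)
HB.instance Definition _ (R : realType) := PseudoPointedMetric.copy R[i] R[i]^o.
HB.instance Definition _ (R : realType) := GRing.ComAlgebra.copy R[i] R[i]^o.
HB.instance Definition _ (R : realType) := Vector.copy R[i] R[i]^o.
HB.instance Definition _ (R : realType) := NormedModule.copy R[i] R[i]^o.

(* The sigma-finite instance of the product [\x] is masked by the one for
   sub-probabilities, hence this copy. *)
Section prod_measure.
Context d1 d2 (T1 : measurableType d1) (T2 : measurableType d2) (R : realType).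
Variables (m1 : {sigma_finite_measure set T1 -> \bar R})
  (m2 : {sigma_finite_measure set T2 -> \bar R}).

Definition prod_measure : set (T1 * T2) -> \bar R := (m1 \x m2)%E.

HB.instance Definition _ := Measure.copy prod_measure (m1 \x m2)%E.

Let prod_measure_sigma_finite : sigma_finite setT prod_measure.
Proof.
have /sigma_finiteP[F [TF ndF Foo]] := sigma_finiteT m1.
have /sigma_finiteP[G [TG ndG Goo]] := sigma_finiteT m2.
exists (fun n => F n `*` G n).
 rewrite -setXTT TF TG predeqE => -[x y]; split.
    move=> [/= [n _ Fnx] [k _ Gky]]; exists (maxn n k) => //; split.
    - by move: x Fnx; exact/subsetPset/ndF/leq_maxl.
    - by move: y Gky; exact/subsetPset/ndG/leq_maxr.
  by move=> [n _ []/= ? ?]; split; exists n.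
move=> k; have [? ?] := Foo k; have [? ?] := Goo k.
split; first exact: measurableX.
by rewrite /prod_measure product_measure1E// lte_mul_pinfty// ge0_fin_numE.
Qed.

HB.instance Definition _ := Measure_isSigmaFinite.Build _ _ _ prod_measure
  prod_measure_sigma_finite.

End prod_measure.

Section tuple_measure.
Context d (T : measurableType d) (R : realType).
Variable mu : {sigma_finite_measure set T -> \bar R}.

Definition tuple_cons n (p : T * n.-tuple T) : n.+1.-tuple T :=
  [the n.+1.-tuple T of p.1 :: p.2].

Definition tuple_uncons n (t : n.+1.-tuple T) : T * n.-tuple T :=
  (thead t, [tuple of behead t]).

Lemma tuple_consK n : cancel (@tuple_cons n) (@tuple_uncons n).
Proof. by case=> x t; congr pair; exact/val_inj. Qed.

Lemma measurable_tuple_cons n : measurable_fun setT (@tuple_cons n).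
Proof. exact: measurable_cons. Qed.

Lemma measurable_tuple_uncons n : measurable_fun setT (@tuple_uncons n).
Proof.
apply/measurable_fun_pairP; split => /=; first exact: measurable_tnth.
exact: measurable_behead.
Qed.

Section cons_measure.
Variables (n : nat) (P : {sigma_finite_measure set (n.-tuple T) -> \bar R}).

Definition cons_measure : set (n.+1.-tuple T) -> \bar R :=
  pushforward (prod_measure mu P) (@tuple_cons n).

HB.instance Definition _ := Measure.copy cons_measure
  (measure_function_pushforward__canonical__measure_function_Measure
     (prod_measure mu P) (@measurable_tuple_cons n)).

Let cons_measure_sigma_finite : sigma_finite setT cons_measure.
Proof.
have [F TF Foo] := sigma_finiteT (prod_measure mu P).
exists (fun k => @tuple_uncons n @^-1` F k).
  by rewrite -preimage_bigcup -TF preimage_setT.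
move=> k; have [mF Fk] := Foo k; split.
  by rewrite -[X in measurable X]setTI; exact: measurable_tuple_uncons.
rewrite /cons_measure /pushforward -comp_preimage.
by rewrite (_ : _ \o _ = id) ?preimage_id//; apply/funext/tuple_consK.
Qed.

HB.instance Definition _ := Measure_isSigmaFinite.Build _ _ _ cons_measure
  cons_measure_sigma_finite.

End cons_measure.

Fixpoint tuple_measure n : {sigma_finite_measure set (n.-tuple T) -> \bar R} :=
  if n is k.+1 then cons_measure (tuple_measure k) else dirac [tuple].

End tuple_measure.

Section complex_space.
Variables (R : realType) (n : nat).
Local Notation Cn := 'rV[R[i]]_n.
Local Notation mR := (measurableTypeR R).
Implicit Types (A : set Cn) (z v p : Cn).

Definition lebesgueC : {sigma_finite_measure set (mR * mR)%type -> \bar R} :=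
  prod_measure (@lebesgue_measure R) (@lebesgue_measure R).

(* Lebesgue measure of C^n, carried by the tuples of pairs (x_j, y_j);
   [cvec] identifies such a tuple with the vector (x_j + i y_j)_j. *)
Definition lebesgueCn : {sigma_finite_measure set (n.-tuple (mR * mR)) -> \bar R} :=
  tuple_measure lebesgueC n.

Definition cvec (t : n.-tuple (mR * mR)) : Cn :=
  \row_j ((tnth t j).1 +i* (tnth t j).2).

Definition integralCn A (F : Cn -> \bar R) : \bar R :=
  (\int[lebesgueCn]_(t in cvec @^-1` A) F (cvec t))%E.

Definition integrableCn A (F : Cn -> \bar R) : Prop :=
  lebesgueCn.-integrable (cvec @^-1` A) (F \o cvec).

Definition sqnormC (w : R[i]) : R := complex.Re w ^+ 2 + complex.Im w ^+ 2.

Definition sqnorm z : R := \sum_(j < n) sqnormC (z 0 j).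

(* The Euclidean norm; the library norm on 'rV[R[i]]_n is the sup norm, with
   values in R[i]. *)
Definition enorm z : R := Num.sqrt (sqnorm z).

Definition eball p (r : R) : set Cn := [set z | enorm (z - p) < r].

(* On open sets A; this also covers maps into C^k. *)
Definition holomorphic_on (W : normedModType R[i]) A (f : Cn -> W) : Prop :=
  forall z, A z -> differentiable f z.

Fixpoint Ck_on (k : nat) A (f : Cn -> R) : Prop :=
  (forall z, A z -> {for z, continuous f}) /\
  if k is k'.+1 then
    forall v, (forall z, A z -> derivable (fun t : R => f (z + t%:C *: v)) 0 1) /\
      Ck_on k' A (fun z => derive1 (fun t : R => f (z + t%:C *: v)) 0)
  else True.

(* C^infinity on the open set A of C^n = R^2n: iterated real directional
   derivatives of all orders exist and are continuous. *)
Definition smooth_on A (f : Cn -> R) : Prop := forall k, Ck_on k A f.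

(* Plurisubharmonic functions are not identically -oo on a component. *)
Record psh_on A (u : Cn -> \bar R) : Prop := PshOn {
  psh_lty : forall z, A z -> (u z < +oo)%E ;
  psh_usc : forall z (a : R), A z -> (u z < a%:E)%E ->
    \forall w \near z, (u w < a%:E)%E ;
  psh_mean : forall z v,
    (forall t : R[i], sqnormC t <= 1 -> A (z + t *: v)) ->
    (u z <= ((pi *+ 2)^-1)%:E *
      \int[lebesgue_measure]_(theta in `[0%R, (pi *+ 2)%R])
        u (z + (cos theta +i* sin theta) *: v)%R)%E ;
  psh_neqNy : forall z, A z ->
    exists2 w, connected_component A z w & u w != -oo%E }.

Definition lelong_at (u : Cn -> \bar R) p : \bar R :=
  limf_einf (fun z => u z * ((ln (enorm (z - p)))^-1)%:E)%E p^'.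

(* The Hilbert space of holomorphic f on B with \int_B |f|^2 w < oo. *)
Definition weighted_bergman (B : set Cn) (w : Cn -> \bar R) : set (Cn -> R[i]) :=
  [set f | holomorphic_on B f /\
    (integralCn B (fun z => (sqnormC (f z))%:E * w z) < +oo)%E].

Definition weighted_inner (B : set Cn) (w : Cn -> \bar R) (f g : Cn -> R[i]) :
    R[i] :=
  fine (integralCn B (fun z => (complex.Re (f z * (g z)^*))%:E * w z)%E) +i*
  fine (integralCn B (fun z => (complex.Im (f z * (g z)^*))%:E * w z)%E).

(* Hilbert basis (orthonormal with dense span), indexed by K \subset nat since
   the space may a priori be finite dimensional. *)
Record orthonormal_basis (B : set Cn) (w : Cn -> \bar R) (K : set nat)
    (s : nat -> Cn -> R[i]) : Prop := OrthonormalBasis {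
  onb_mem : forall k, K k -> weighted_bergman B w (s k) ;
  onb_orth : forall k l, K k -> K l ->
    weighted_inner B w (s k) (s l) = (k == l)%:R ;
  onb_dense : forall f (e : R), weighted_bergman B w f -> 0 < e ->
    exists N (c : nat -> R[i]),
      (integralCn B (fun z => (sqnormC (f z -
        \sum_(k < N | (k : nat) \in K) c k * s k z)%R)%:E * w z) < e%:E)%E }.

End complex_space.

Section manifold.
Variables (R : realType) (n : nat) (X : topologicalType).
Local Notation Cn := 'rV[R[i]]_n.

Record chart := Chart {
  chart_dom : set X ;
  chart_img : set Cn ;
  chart_fun : X -> Cn ;
  chart_inv : Cn -> X ;
  chart_dom_open : open chart_dom ;
  chart_img_open : open chart_img ;
  chart_funP : forall x, chart_dom x -> chart_img (chart_fun x) ;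
  chart_invP : forall z, chart_img z -> chart_dom (chart_inv z) ;
  chart_funK : forall x, chart_dom x -> chart_inv (chart_fun x) = x ;
  chart_invK : forall z, chart_img z -> chart_fun (chart_inv z) = z ;
  chart_fun_cont : forall x, chart_dom x -> {for x, continuous chart_fun} ;
  chart_inv_cont : forall z, chart_img z -> {for z, continuous chart_inv} }.

Definition holomorphic_transition (c d : chart) : Prop :=
  holomorphic_on (chart_img c `&` chart_inv c @^-1` chart_dom d)
    (chart_fun d \o chart_inv c).

(* The atlas is given by a preferred chart at each point. *)
Record complex_manifold := ComplexManifold {
  chart_at : X -> chart ;
  chart_at_dom : forall x, chart_dom (chart_at x) x ;
  chart_at_transition : forall x y,
    holomorphic_transition (chart_at x) (chart_at y) ;
  manifold_hausdorff : hausdorff_space X ;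
  manifold_second_countable : @second_countable X }.

Variable M : complex_manifold.
Implicit Types (W : set X) (phi : X -> \bar R).

(* The maximal atlas. *)
Definition holomorphic_chart (c : chart) : Prop := forall x,
  holomorphic_transition c (chart_at M x) /\
  holomorphic_transition (chart_at M x) c.

Definition chart_nbhd W (x : X) (c : chart) (N : set Cn) : Prop :=
  holomorphic_chart c /\
  [/\ chart_dom c x, open N, N (chart_fun c x), N `<=` chart_img c &
      chart_inv c @` N `<=` W].

(* For W open. The notions below are invariant under holomorphic changes of
   coordinates, so it is enough that they hold in one chart at each point. *)
Definition mholomorphic W (f : X -> R[i]) : Prop := forall x, W x ->
  exists c N, chart_nbhd W x c N /\ holomorphic_on N (f \o chart_inv c).

Definition msmooth W phi : Prop := forall x, W x ->
  exists c N, chart_nbhd W x c N /\ exists2 g : Cn -> R, smooth_on N g &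
    forall z, N z -> phi (chart_inv c z) = (g z)%:E.

Definition quasi_psh W phi : Prop := forall x, W x ->
  exists c N, chart_nbhd W x c N /\ exists u g, [/\ psh_on N u, smooth_on N g &
    forall z, N z -> phi (chart_inv c z) = (u z + (g z)%:E)%E].

Definition analytic_subset W (A : set X) : Prop := A `<=` W /\
  forall x, W x -> exists c N, chart_nbhd W x c N /\
    exists k (f : 'I_k -> Cn -> R[i]), (forall i, holomorphic_on N (f i)) /\
      forall z, N z -> A (chart_inv c z) <-> forall i, f i z = 0.

Definition lelong phi (x : X) : \bar R :=
  lelong_at (phi \o chart_inv (chart_at M x)) (chart_fun (chart_at M x) x).

(* An ideal sheaf is given by its stalks: [I x f] means that the germ at x of f
   belongs to I_x. *)
Definition ideal_stalks := X -> (X -> R[i]) -> Prop.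

Definition multiplier_ideal phi : ideal_stalks := fun x f =>
  (exists W, [/\ open W, W x & mholomorphic W f]) /\
  exists c N, chart_nbhd setT x c N /\
    integrableCn N (fun z => (sqnormC (f (chart_inv c z)))%:E *
      expeR ((- 2)%:E * phi (chart_inv c z)))%E.

Definition zero_locus (I : ideal_stalks) : set X :=
  [set x | forall f, I x f -> f x = 0].

(* Line bundle given by a cocycle: the coordinates of a section over two
   trivializing sets are related by s_i = g_ij s_j. *)
Record line_bundle := LineBundle {
  lb_index : Type ;
  lb_dom : lb_index -> set X ;
  lb_cocycle : lb_index -> lb_index -> X -> R[i] ;
  lb_dom_open : forall i, open (lb_dom i) ;
  lb_dom_cover : \bigcup_i lb_dom i = setT ;
  lb_cocycle_holo : forall i j,
    mholomorphic (lb_dom i `&` lb_dom j) (lb_cocycle i j) ;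
  lb_cocycle_neq0 : forall i j x, lb_dom i x -> lb_dom j x ->
    lb_cocycle i j x != 0 ;
  lb_cocycle_id : forall i x, lb_dom i x -> lb_cocycle i i x = 1 ;
  lb_cocycle_comp : forall i j k x, lb_dom i x -> lb_dom j x -> lb_dom k x ->
    lb_cocycle i j x * lb_cocycle j k x = lb_cocycle i k x }.

(* |s|^2 = sm_density i * |s_i|^2 over [lb_dom L i]. *)
Record smooth_metric (L : line_bundle) := SmoothMetric {
  sm_density : lb_index L -> X -> R ;
  sm_density_gt0 : forall i x, lb_dom i x -> 0 < sm_density i x ;
  sm_density_smooth : forall i,
    msmooth (lb_dom i) (fun x => (sm_density i x)%:E) ;
  sm_density_change : forall i j x, lb_dom i x -> lb_dom j x ->
    sm_density j x = sqnormC (lb_cocycle i j x) * sm_density i x }.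

Record singular_metric (L : line_bundle) := SingularMetric {
  h_density : lb_index L -> X -> \bar R ;
  h_smooth : smooth_metric L ;
  h_weight : X -> \bar R ;
  h_weight_qpsh : quasi_psh setT h_weight ;
  h_densityE : forall i x, lb_dom i x ->
    h_density i x =
      ((sm_density h_smooth i x)%:E * expeR ((- 2)%:E * h_weight x))%E }.

(* I(h^m) = I(m phi) for h = h_0 e^(-2 phi). *)
Definition metric_multiplier_ideal (L : line_bundle) (h : singular_metric L)
    (m : nat) : ideal_stalks :=
  multiplier_ideal (fun x => m%:R%:E * h_weight h x)%E.

Definition exhaustive_covering (U : nat -> set X) : Prop :=
  [/\ forall j, open (U j), forall j, compact (closure (U j)),
      forall j, closure (U j) `<=` U j.+1 & \bigcup_j U j = setT].

(* The weight e^(-2m(phi + a|z|^2)) in the chart c. *)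
Definition bergman_weight (c : chart) phi (m : nat) (a : R) (z : Cn) : \bar R :=
  expeR ((- (2 * m%:R))%:E * (phi (chart_inv c z) + (a * sqnorm z)%:E)).

Record demailly_approximation (U : nat -> set X) phi (nu m : nat -> nat)
    (psi : nat -> X -> \bar R) (Z : nat -> set X) : Prop :=
  DemaillyApproximation {
  dem_nu_gt0 : forall j, (0 < nu j)%N ;
  dem_m_gt0 : forall j, (0 < m j)%N ;
  dem_nu_incr : {homo nu : i j / (i <= j)%N} ;
  dem_m_cvg : m j @[j --> \oo] --> \oo ;
  dem_psi_qpsh : forall j, quasi_psh (U j) (psi j) ;
  dem_local : forall j x, U j x ->
    exists c N p r a K s g,
      [/\ chart_nbhd (U j) x c N,
          eball p r `<=` chart_img c /\ N `<=` eball p r,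
          orthonormal_basis (eball p r) (bergman_weight c phi (m j) a) K s,
          smooth_on N g &
          forall z, N z ->
            psi j (chart_inv c z) =
              (((1 + 2 ^- nu j) / (2 * (m j)%:R))%:E *
                 lne (\esum_(k in K) (sqnormC (s k z))%:E) + (g z)%:E)%E /\
            (Z j (chart_inv c z) <-> forall k, K k -> s k z = 0)] ;
  dem_poles : forall j, Z j = [set x | U j x /\ psi j x = -oo%E] ;
  dem_analytic : forall j, analytic_subset (U j) (Z j) ;
  dem_smooth : forall j, msmooth (U j `\` Z j) (psi j) ;
  dem_incl : forall j, Z j `<=` Z j.+1 `&` U j ;
  dem_lelong : forall j x, U j x ->
    let nu_psi := lelong (fun y => ((1 + 2 ^- nu j)^-1)%:E * psi j y)%E x in
    (lelong phi x - (n%:R / (m j)%:R)%:E <= nu_psi)%E /\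
    (nu_psi <= lelong phi x)%E }.

End manifold.

(* Main.v *)
Require Import Defs.
From mathcomp Require Import all_boot all_order all_algebra.
From mathcomp Require Import all_classical all_reals all_analysis.
From mathcomp Require Import measurable_realfun complex.
From mathcomp Require finmap.
From mathcomp Require Import ring lra zify.

Import Order.TTheory GRing.Theory Num.Theory.
Import numFieldNormedType.Exports.
Import ComplexField.Normc.

Local Open Scope classical_set_scope.
Local Open Scope ring_scope.

Set Implicit Arguments.
Unset Strict Implicit.
Unset Printing Implicit Defensive.
(** The two equalities follow from a cycle of inclusions: {nu > 0} is contained
    in the union of the V(I(h^k)), which is contained in the union of the Z_j,
    which is contained in {nu > 0}.

    - If nu(phi, x) > 0, then phi <= gamma log (C |z - x|) near x for some
      gamma > 0.  Once k gamma >= n + 1, the weight e^(-2 k phi) is at least a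
      multiple of |z - x|^(-2 (n + 1)), which is too large to be integrable in
      real dimension 2 n: a cube of side comparable to e, at distance comparable
      to e from x, already contributes a multiple of e^(-2).  A germ of I(k phi)
      therefore vanishes at x ([lelong_zero_locus], [pole_not_integrable]).

    - Let x be a zero of I(k phi), and take j with x in X_j and m_j >= k.  If x
      were outside Z_j, some sigma of the orthonormal basis would satisfy
      sigma(x) <> 0.  Since phi is bounded above near x and k <= m_j, the
      integrability of |sigma|^2 e^(-2 m_j phi) gives that of
      |sigma|^2 e^(-2 k phi), so sigma would be a germ of I(k phi) that does not
      vanish at x ([zero_locus_poles]).

    - Let x be in Z_j, so that every sigma_k vanishes at x.  The sum of the
      |sigma_k|^2 is bounded near x because psi_j is upper semicontinuous.  A
      Schwarz lemma whose constants do not depend on the number of functions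
      bounds this sum by C |z - x|^2, so psi_j has a positive Lelong number at
      x, and hence so has phi ([schwarz_family], [poles_lelong]).

    The Schwarz lemma is proved for functions that are only known to be complex
    differentiable at each point.  Contour integrals are replaced by midpoint
    Riemann sums over the boundary of a square.  These sums are exactly additive
    when a square is cut into four and they vanish on affine functions, so the
    bisection argument of Goursat shows that they tend to 0 under refinement
    ([goursat]), also when the function has a few exceptional points at which it
    is merely bounded ([square_null_lattice]).  For f with f(0) = 0, bounded by
    A on the square of half side l, this is applied to the Cauchy kernel
    (f(w)/w - f(2)/2)/(w - 2).  The sums of 1/(w - 2) stay away from 0, whence
    |f(2)| <= 16 A / l ([schwarz_square]). *)

(** * The complex modulus *)

Section Contour.
Variable R : realType.
Implicit Types (k : R[i] -> R[i]) (z d w : R[i]).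

Lemma normc_ge0 (x : R[i]) : 0 <= normc x.
Proof. by case: x => a b; exact: sqrtr_ge0. Qed.

Lemma normc_triangle (x y : R[i]) : normc (x + y) <= normc x + normc y.
Proof. exact: le_normcD. Qed.

Lemma normc_opp (x : R[i]) : normc (- x) = normc x.
Proof. exact: normcN. Qed.

Lemma normc_triangleB (x y : R[i]) : normc (x - y) <= normc x + normc y.
Proof. by rewrite -(normc_opp y); exact: normc_triangle. Qed.

Lemma normc_subl (x y : R[i]) : normc x - normc y <= normc (x - y).
Proof. by rewrite lerBlDr; have := normc_triangle (x - y) y; rewrite subrK. Qed.

Lemma normc_sum N (F : nat -> R[i]) :
  normc (\sum_(i < N) F i) <= \sum_(i < N) normc (F i).
Proof.
elim: N => [|N IH]; first by rewrite !big_ord0 normc0.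
rewrite !big_ord_recr /=; apply: (le_trans (normc_triangle _ _)).
by rewrite lerD2r.
Qed.

Lemma normc_real (x : R) : normc (x%:C)%C = `|x|.
Proof. by rewrite /= expr0n /= addr0 sqrtr_sqr. Qed.

Lemma normc_nat (p : nat) : normc (p%:R : R[i]) = p%:R.
Proof.
have -> : (p%:R : R[i]) = (p%:R%:C)%C by rewrite rmorph_nat.
by rewrite normc_real ger0_norm.
Qed.

Lemma normc_i : normc ('i%C : R[i]) = 1.
Proof. by rewrite /= expr0n /= add0r expr1n sqrtr1. Qed.

Lemma normc_le_abs (s t : R) : normc (s%:C%C + 'i%C * t%:C%C) <= `|s| + `|t|.
Proof.
apply: (le_trans (normc_triangle _ _)).
by rewrite normcM normc_i mul1r !normc_real.
Qed.

Lemma abs_Re_le_normc (x : R[i]) : `|complex.Re x| <= normc x.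
Proof.
case: x => a b /=; rewrite -sqrtr_sqr ler_sqrt ?lerDl ?sqr_ge0 //.
by rewrite addr_ge0 ?sqr_ge0.
Qed.

Lemma abs_Im_le_normc (x : R[i]) : `|complex.Im x| <= normc x.
Proof.
case: x => a b /=; rewrite -sqrtr_sqr ler_sqrt ?lerDr ?sqr_ge0 //.
by rewrite addr_ge0 ?sqr_ge0.
Qed.

Lemma realCM (x y : R) : (x * y)%:C%C = x%:C%C * y%:C%C :> R[i].
Proof. exact: rmorphM. Qed.

Lemma realCB (x y : R) : (x - y)%:C%C = x%:C%C - y%:C%C :> R[i].
Proof. exact: rmorphB. Qed.

Lemma realCV (x : R) : (x^-1)%:C%C = (x%:C%C)^-1 :> R[i].
Proof. exact: fmorphV. Qed.

Lemma realCn (p : nat) : (p%:R)%:C%C = p%:R :> R[i].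
Proof. exact: rmorph_nat. Qed.

(** * Midpoint sums along the boundary of a square *)

(** The midpoint of the [i]-th of [N] equal subintervals of the unit interval:
    with midpoints the sums below are exact on affine functions. *)
Definition node (N i : nat) : R := (i%:R + 2^-1) / N%:R.

(** A Riemann sum for the integral of [k dw] along the segment from [z] to
    [z + d]. *)
Definition edge_sum k N z d : R[i] :=
  (\sum_(i < N) k (z + (node N i)%:C%C * d)) * (d / N%:R).

(** Sides are complex numbers: the square has the vertices [z], [z + d],
    [z + d + i d], [z + i d], run through in this order, so that rotated squares
    are covered as well. *)
Definition square_sum k N z d : R[i] :=
  edge_sum k N z d + edge_sum k N (z + d) ('i%C * d) -
  edge_sum k N (z + 'i%C * d) d - edge_sum k N z ('i%C * d).

Definition closed_square z d : set R[i] :=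
  [set w | exists s t : R, [/\ 0 <= s <= 1, 0 <= t <= 1 &
     w = z + (s%:C%C + 'i%C * t%:C%C) * d]].

Lemma node_itv N i : (i < N)%N -> 0 <= node N i <= 1.
Proof.
move=> iN; have N0 : (0 : R) < N%:R by rewrite ltr0n; lia.
rewrite /node ler_pdivlMr // ler_pdivrMr // mul0r mul1r.
have : (i.+1%:R : R) <= N%:R by rewrite ler_nat.
have : (0 : R) <= i%:R by [].
by rewrite -natr1; lra.
Qed.

(** Doubling the number of nodes while cutting the edge in two keeps the same
    sample points; this is why additivity holds without any limit. *)
Lemma edge_sum_double k N z h :
  edge_sum k (N + N) z (h + h) = edge_sum k N z h + edge_sum k N (z + h) h.
Proof.
case: N => [|N]; first by rewrite /edge_sum !big_ord0 !mul0r addr0.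
have N0 : (N.+1%:R : R) != 0 by rewrite pnatr_eq0.
have N0' : (N.+1%:R : R[i]) != 0 by rewrite pnatr_eq0.
rewrite /edge_sum big_split_ord /= -mulrDl.
have -> : (h + h) / (N.+1 + N.+1)%:R = h / N.+1%:R :> R[i].
  have DC : (N.+1%:R + N.+1%:R : R[i]) != 0 by rewrite -natrD pnatr_eq0.
  by rewrite natrD; field; apply/andP; split.
have DN : (N.+1%:R + N.+1%:R : R) != 0 by rewrite -natrD pnatr_eq0.
congr ((_ + _) * _); apply: eq_bigr => i _; congr k.
  have -> : node N.+1 i = node (N.+1 + N.+1) i * 2.
    by rewrite /node natrD; field; apply/andP; split.
  by rewrite (realCM _ 2) (realCn 2); ring.
have -> : node N.+1 i = node (N.+1 + N.+1) (N.+1 + i) * 2 - 1.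
  by rewrite /node !natrD; field; apply/andP; split.
by rewrite realCB (realCM _ 2) (realCn 2) (realCn 1); ring.
Qed.

Lemma edge_sum_rev k N z d : edge_sum k N (z + d) (- d) = - edge_sum k N z d.
Proof.
case: N => [|N]; first by rewrite /edge_sum !big_ord0 !mul0r oppr0.
have N0 : (N.+1%:R : R) != 0 by rewrite pnatr_eq0.
rewrite /edge_sum mulNr mulrN; congr (- (_ * _)).
rewrite (reindex_inj rev_ord_inj) /=; apply: eq_bigr => i _; congr k.
have -> : node N.+1 (N.+1 - i.+1) = 1 - node N.+1 i.
  rewrite /node natrB; last exact: ltn_ord.
  by rewrite -[i.+1%:R]natr1; field.
by rewrite (realCB 1) (realCn 1); ring.
Qed.

(** The sums over the four inner edges cancel in pairs. *)
Lemma square_sum_double k N z h :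
  square_sum k (N + N) z (h + h) =
    square_sum k N z h + square_sum k N (z + h) h +
    square_sum k N (z + 'i%C * h) h + square_sum k N (z + h + 'i%C * h) h.
Proof.
rewrite /square_sum mulrDr !edge_sum_double.
have e1 : z + (h + h) = z + h + h by rewrite addrA.
have e2 : z + ('i%C * h + 'i%C * h) + h = z + h + 'i%C * h + 'i%C * h by ring.
have e3 : z + (h + h) + 'i%C * h = z + h + 'i%C * h + h by ring.
have e4 : z + ('i%C * h + 'i%C * h) = z + 'i%C * h + 'i%C * h by ring.
have e5 : z + 'i%C * h + h = z + h + 'i%C * h by ring.
by rewrite e2 e3 e1 e4 e5; ring.
Qed.

(** Starting from the next vertex: this reduces a statement about any corner of
    a square to the corner [z]. *)
Lemma square_sum_rot k N z d :
  square_sum k N (z + d) ('i%C * d) = square_sum k N z d.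
Proof.
have ii : 'i%C * ('i%C * d) = - d.
  by rewrite mulrA -expr2 sqr_i mulN1r.
rewrite /square_sum ii edge_sum_rev.
have -> : z + d + 'i%C * d = z + 'i%C * d + d by ring.
by rewrite edge_sum_rev addrK; ring.
Qed.

Lemma edge_sumD k1 k2 N z d :
  edge_sum (fun w => k1 w + k2 w) N z d = edge_sum k1 N z d + edge_sum k2 N z d.
Proof. by rewrite /edge_sum big_split mulrDl. Qed.

Lemma edge_sumZ c k N z d :
  edge_sum (fun w => c * k w) N z d = c * edge_sum k N z d.
Proof. by rewrite /edge_sum -mulr_sumr -mulrA. Qed.

Lemma square_sumD k1 k2 N z d :
  square_sum (fun w => k1 w + k2 w) N z d =
  square_sum k1 N z d + square_sum k2 N z d.
Proof. by rewrite /square_sum !edge_sumD; ring. Qed.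

Lemma square_sumZ c k N z d :
  square_sum (fun w => c * k w) N z d = c * square_sum k N z d.
Proof. by rewrite /square_sum !edge_sumZ; ring. Qed.

Lemma edge_sum_affine a b N z d : (0 < N)%N ->
  edge_sum (fun w => a + b * w) N z d = (a + b * (z + d / 2)) * d.
Proof.
move=> N0; have NR : (N%:R : R) != 0 by rewrite pnatr_eq0 -lt0n.
have NC : (N%:R : R[i]) != 0 by rewrite pnatr_eq0 -lt0n.
have sumn : \sum_(i < N) node N i = N%:R / 2 :> R.
  rewrite /node -mulr_suml.
  suff -> : \sum_(i < N) (i%:R + 2^-1) = N%:R ^+ 2 / 2 :> R by field.
  elim: N {N0 NR NC} => [|N IH]; first by rewrite big_ord0 expr0n mul0r.
  by rewrite big_ord_recr /= IH -natr1; field.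
have sumC : \sum_(i < N) (node N i)%:C%C = N%:R / 2 :> R[i].
  rewrite -(realCn N) -(realCn 2) -realCV -realCM -sumn.
  by symmetry; exact: (rmorph_sum (real_complex R)).
rewrite /edge_sum big_split /= sumr_const card_ord -mulr_sumr big_split /=.
rewrite sumr_const card_ord -mulr_suml sumC.
by rewrite -[a *+ N]mulr_natr -[z *+ N]mulr_natr; field.
Qed.

Lemma square_sum_affine a b N z d : (0 < N)%N ->
  square_sum (fun w => a + b * w) N z d = 0.
Proof.
move=> N0; rewrite /square_sum !edge_sum_affine //.
by field.
Qed.

Lemma edge_sum_bound k N z d (B : R) :
  (forall s : R, 0 <= s <= 1 -> normc (k (z + s%:C%C * d)) <= B) -> 0 <= B ->
  normc (edge_sum k N z d) <= B * normc d.
Proof.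
move=> kB B0; case: N => [|N].
  by rewrite /edge_sum big_ord0 mul0r normc0 mulr_ge0 ?normc_ge0.
have N0 : (0 : R) < N.+1%:R by rewrite ltr0n.
rewrite /edge_sum normcM normcM normcV normc_nat mulrCA mulrC.
rewrite ler_wpM2r ?normc_ge0 // ler_pdivrMr //.
apply: (le_trans (normc_sum _ (fun i => k (z + (node N.+1 i)%:C%C * d)))).
apply: (@le_trans _ _ (\sum_(i < N.+1) B)).
  by apply: ler_sum => i _; apply/kB/node_itv.
rewrite sumr_const card_ord. by rewrite -[B *+ _]mulr_natr.
Qed.

Definition square_boundary z d : set R[i] := [set w | exists2 s : R, 0 <= s <= 1 &
  [\/ w = z + s%:C%C * d, w = z + d + s%:C%C * ('i%C * d),
      w = z + 'i%C * d + s%:C%C * d | w = z + s%:C%C * ('i%C * d)]].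

Lemma square_boundary_closed_square z d w : square_boundary z d w -> closed_square z d w.
Proof.
have i1 : 0 <= (0 : R) <= (1 : R) by rewrite lexx ler01.
have i2 : 0 <= (1 : R) <= (1 : R) by rewrite lexx ler01.
move=> [s s01 [] ->]; [exists s, 0|exists 1, s|exists s, 1|exists 0, s];
  by split => //; rewrite ?(realCn 0) ?(realCn 1); ring.
Qed.

Lemma square_sum_bound k N z d (B : R) :
  (forall w, square_boundary z d w -> normc (k w) <= B) ->
  normc (square_sum k N z d) <= 4 * B * normc d.
Proof.
move=> kB; have i1 : 0 <= (0 : R) <= (1 : R) by rewrite lexx ler01.
have B0 : 0 <= B.
  apply: (le_trans (normc_ge0 (k z))); apply: kB; exists 0 => //.
  by apply: Or41; rewrite (realCn 0); ring.
have nid : normc ('i%C * d) = normc d by rewrite normcM normc_i mul1r.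
have e1 : normc (edge_sum k N z d) <= B * normc d.
  by apply: edge_sum_bound => // s s01; apply: kB; exists s => //; apply: Or41.
have e2 : normc (edge_sum k N (z + d) ('i%C * d)) <= B * normc d.
  rewrite -[in X in _ <= X]nid; apply: edge_sum_bound => // s s01.
  by apply: kB; exists s => //; apply: Or42.
have e3 : normc (edge_sum k N (z + 'i%C * d) d) <= B * normc d.
  by apply: edge_sum_bound => // s s01; apply: kB; exists s => //; apply: Or43.
have e4 : normc (edge_sum k N z ('i%C * d)) <= B * normc d.
  rewrite -[in X in _ <= X]nid; apply: edge_sum_bound => // s s01.
  by apply: kB; exists s => //; apply: Or44.
rewrite /square_sum.
apply: (le_trans (normc_triangleB _ _)).
apply: (@le_trans _ _ (B * normc d + B * normc d + B * normc d + B * normc d)); last by lra.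
apply: lerD => //; apply: (le_trans (normc_triangleB _ _)).
apply: lerD => //; apply: (le_trans (normc_triangle _ _)).
exact: lerD.
Qed.

End Contour.

(** * Goursat's theorem for midpoint sums *)
Section Goursat.
Lemma half_exprn_small (R : realType) (e : R) : 0 < e ->
  exists j, 2^-1 ^+ j < e.
Proof.
move=> e0; have := @cvg_geometric R 1 2^-1; rewrite ger0_norm ?invr_ge0 //.
have half1 : (2^-1 : R) < 1 by rewrite invf_lt1 ?ltr1n.
move=> /(_ half1) /cvgrPdist_lt /(_ e e0) [N _ /(_ N (leqnn N))] /=.
rewrite sub0r normrN /geometric /= mul1r ger0_norm ?exprn_ge0 // => H.
by exists N.
Qed.

Variable R : realType.
Implicit Types (k : R[i] -> R[i]) (z d w : R[i]).

Definition cderivable k w := exists L, forall e : R, 0 < e ->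
  exists2 r : R, 0 < r & forall w', normc (w' - w) < r ->
    normc (k w' - k w - L * (w' - w)) <= e * normc (w' - w).

Lemma closed_square_corner z d : closed_square z d z.
Proof.
by exists 0, 0; rewrite !lexx !ler01; split => //; rewrite (realCn _ 0); ring.
Qed.

Lemma closed_square_diam z d w w' : closed_square z d w -> closed_square z d w' ->
  normc (w' - w) <= 2 * normc d.
Proof.
move=> [s [t [s01 t01 ->]]] [s' [t' [s01' t01' ->]]].
have -> : z + (s'%:C%C + 'i%C * t'%:C%C) * d - (z + (s%:C%C + 'i%C * t%:C%C) * d) =
    ((s' - s)%:C%C + 'i%C * (t' - t)%:C%C) * d.
  by rewrite !realCB; ring.
rewrite normcM ler_wpM2r ?normc_ge0 //.
apply: (le_trans (normc_le_abs _ _)).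
have {}s01 : `|s' - s| <= 1 by rewrite ler_norml; lra.
have {}t01 : `|t' - t| <= 1 by rewrite ler_norml; lra.
by lra.
Qed.

(** The bound is proportional to the area of the square, so that it passes from
    the four quarters of a square to the square. *)
Definition square_small (eta : R) k z d := exists N0, forall N, (N0 <= N)%N ->
  normc (square_sum k (2 ^ N) z d) <= eta * normc d ^+ 2.

Definition square_null k z d := forall e : R, 0 < e ->
  exists N0, forall N, (N0 <= N)%N -> normc (square_sum k (2 ^ N) z d) <= e.

Lemma square_sum_double_exp k N z h :
  square_sum k (2 ^ N.+1) z (h + h) =
    square_sum k (2 ^ N) z h + square_sum k (2 ^ N) (z + h) h +
    square_sum k (2 ^ N) (z + 'i%C * h) h +
    square_sum k (2 ^ N) (z + h + 'i%C * h) h.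
Proof. by rewrite expnS mul2n -addnn square_sum_double. Qed.

Lemma normc_triangle4 (a b c e : R[i]) (x : R) : normc a <= x -> normc b <= x ->
  normc c <= x -> normc e <= x -> normc (a + b + c + e) <= 4 * x.
Proof.
move=> ax bx cx ex; apply: (le_trans (normc_triangle _ _)).
have := normc_triangle (a + b) c; have := normc_triangle a b.
by lra.
Qed.

Lemma square_small_double eta k z h :
  square_small eta k z h -> square_small eta k (z + h) h ->
  square_small eta k (z + 'i%C * h) h -> square_small eta k (z + h + 'i%C * h) h ->
  square_small eta k z (h + h).
Proof.
move=> [N1 H1] [N2 H2] [N3 H3] [N4 H4].
exists (N1 + N2 + N3 + N4).+1 => -[//|N]; rewrite ltnS => leN.
rewrite square_sum_double_exp.
have -> : eta * normc (h + h) ^+ 2 = 4 * (eta * normc h ^+ 2).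
  have -> : h + h = 2%:R * h by ring.
  by rewrite normcM normc_nat exprMn; ring.
by apply: normc_triangle4; [apply: H1|apply: H2|apply: H3|apply: H4]; lia.
Qed.

Lemma square_null_double k z h :
  square_null k z h -> square_null k (z + h) h ->
  square_null k (z + 'i%C * h) h -> square_null k (z + h + 'i%C * h) h ->
  square_null k z (h + h).
Proof.
move=> H1 H2 H3 H4 e e0.
have e4 : 0 < e / 4 by rewrite divr_gt0.
have [N1 {}H1] := H1 _ e4; have [N2 {}H2] := H2 _ e4.
have [N3 {}H3] := H3 _ e4; have [N4 {}H4] := H4 _ e4.
exists (N1 + N2 + N3 + N4).+1 => -[//|N]; rewrite ltnS => leN.
rewrite square_sum_double_exp.
have -> : e = 4 * (e / 4) by field.
by apply: normc_triangle4; [apply: H1|apply: H2|apply: H3|apply: H4]; lia.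
Qed.

(** Near a point of differentiability the function is affine up to an error
    small compared to the side, and the affine part contributes 0. *)
Lemma square_small_local eta k w : 0 < eta -> cderivable k w ->
  exists2 r : R, 0 < r & forall z d, closed_square z d w -> 2 * normc d < r ->
    square_small eta k z d.
Proof.
move=> eta0 [L /(_ (eta / 8))]; case; first by rewrite divr_gt0.
move=> r r0 kr; exists r => // z d zw dr; exists 0%N => N _.
pose err w' := k w' - (k w - L * w + L * w').
have -> : k = (fun w' => (k w - L * w + L * w') + err w').
  by apply/funext => w'; rewrite /err; ring.
rewrite square_sumD square_sum_affine ?expn_gt0 // add0r.
have -> : eta * normc d ^+ 2 = 4 * (eta / 8 * (2 * normc d)) * normc d.
  by field.
apply: square_sum_bound => w' /square_boundary_closed_square zw'.
have -> : err w' = k w' - k w - L * (w' - w) by rewrite /err; ring.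
have diam := closed_square_diam zw zw'.
apply: (le_trans (kr _ (le_lt_trans diam dr))).
by rewrite ler_wpM2l // ltW // divr_gt0.
Qed.

Lemma nested_dyadic (s : nat -> R) :
  (forall j, s j <= s j.+1 <= s j + 2^-1 ^+ j.+1) ->
  exists S, forall j, s j <= S <= s j + 2^-1 ^+ j.
Proof.
move=> H.
have nd j p : s j <= s (j + p)%N.
  elim: p => [|p IH]; first by rewrite addn0.
  by rewrite addnS; apply: (le_trans IH); have /andP[] := H (j + p)%N.
have ub j p : s (j + p)%N + 2^-1 ^+ (j + p) <= s j + 2^-1 ^+ j.
  elim: p => [|p IH]; first by rewrite addn0.
  rewrite addnS; apply: le_trans IH; have /andP[_] := H (j + p)%N.
  have : 2^-1 ^+ (j + p) = 2^-1 ^+ (j + p).+1 + 2^-1 ^+ (j + p).+1 :> R.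
    by rewrite exprS; field.
  by lra.
have pos p : 0 <= 2^-1 ^+ p :> R by rewrite exprn_ge0.
have sub i j : s i <= s j + 2^-1 ^+ j.
  have [ij|/ltnW ji] := leqP i j.
    by have := nd i (j - i)%N; rewrite subnKC //; have := pos j; lra.
  by have := ub j (i - j)%N; rewrite subnKC //; have := pos i; lra.
exists (sup (range s)) => j; apply/andP; split.
  apply: ub_le_sup; last by exists j.
  by exists (s 0%N + 2^-1 ^+ 0) => _ [i _ <-].
apply: ge_sup; first by exists (s 0%N), 0%N.
by move=> _ [i _ <-].
Qed.

(** Bisection: if the bound failed on the square it would fail on one of its
    quarters, and so on along nested squares.  These shrink to a point, where
    [square_small_local] contradicts the failure. *)
Lemma goursat_small eta k z d : 0 < eta ->
  (forall w, closed_square z d w -> cderivable k w) -> square_small eta k z d.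
Proof.
move=> eta0 kd; apply: contrapT => bad0.
(* The nested squares are recorded by the real coordinates [p] of their corners
   in the initial square, which makes them a pair of dyadic nested intervals. *)
pose c j : R := 2^-1 ^+ j.
pose corner (p : R * R) := z + (p.1%:C%C + 'i%C * p.2%:C%C) * d.
pose side j := (c j)%:C%C * d.
pose bad j p := ~ square_small eta k (corner p) (side j).
have c_ge0 j : 0 <= c j by rewrite /c exprn_ge0.
have cS j : c j = c j.+1 + c j.+1 by rewrite /c exprS; field.
have sideS j : side j = side j.+1 + side j.+1.
  by rewrite /side {1}cS (rmorphD (real_complex R)) mulrDl.
have step (q : nat * (R * R)) : exists p' : R * R, bad q.1 q.2 ->
    [/\ bad q.1.+1 p', q.2.1 <= p'.1 <= q.2.1 + c q.1.+1 &
        q.2.2 <= p'.2 <= q.2.2 + c q.1.+1].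
  case: q => j [s t] /=; have [badq|] := pselect (bad j (s, t)); last by exists 0.
  apply: contrapT => noP; apply: badq; rewrite sideS.
  have good (a b : R) : 0 <= a <= c j.+1 -> 0 <= b <= c j.+1 ->
      square_small eta k (corner (s + a, t + b)) (side j.+1).
    move=> ha hb; apply: contrapT => nsm; apply: noP; exists (s + a, t + b) => _.
    by split => //=; lra.
  have cj0 : 0 <= (0 : R) <= c j.+1 by rewrite lexx c_ge0.
  have cj1 : 0 <= c j.+1 <= c j.+1 by rewrite lexx c_ge0.
  have cornerE a b : corner (s + a, t + b) =
      corner (s, t) + (a%:C%C * d) + 'i%C * (b%:C%C * d).
    by rewrite /corner /= !(rmorphD (real_complex R)) /=; ring.
  have z0 : (0%:C%C : R[i]) * d = 0 by rewrite mul0r.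
  apply: square_small_double.
  - by have := good 0 0 cj0 cj0; rewrite !addr0.
  - by have := good (c j.+1) 0 cj1 cj0; rewrite cornerE z0 mulr0 addr0.
  - by have := good 0 (c j.+1) cj0 cj1; rewrite cornerE z0 addr0.
  - by have := good (c j.+1) (c j.+1) cj1 cj1; rewrite cornerE.
have [F HF] := choice step.
pose p := fix p j := if j is j'.+1 then F (j', p j') else (0 : R, 0 : R).
have badp j : bad j (p j).
  elim: j => [|j IH]; last by have [] := HF (j, p j) IH.
  rewrite /bad /corner /side /c /= expr0 mul1r.
  by rewrite (_ : _ + _ * d = z) //; rewrite (realCn _ 0); ring.
have [S HS] := nested_dyadic (s := fun j => (p j).1)
  (fun j => let: And3 _ h _ := HF (j, p j) (badp j) in h).
have [T HT] := nested_dyadic (s := fun j => (p j).2)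
  (fun j => let: And3 _ _ h := HF (j, p j) (badp j) in h).
pose w := z + (S%:C%C + 'i%C * T%:C%C) * d.
have zw : closed_square z d w.
  by exists S, T; split => //; [have := HS 0%N|have := HT 0%N]; rewrite /= add0r expr0.
have [r r0 Hr] := square_small_local eta0 (kd _ zw).
have [j jr] : exists j, 2 * normc (side j) < r.
  have d0 := normc_ge0 d.
  have [j Hj] : exists j, 2^-1 ^+ j < r / (2 * normc d + 1).
    by apply: half_exprn_small; rewrite divr_gt0 //; lra.
  exists j; rewrite /side normcM normc_real ger0_norm //.
  move: Hj; rewrite -/(c j) ltr_pdivlMr; last by lra.
  by have := c_ge0 j; nra.
apply: (badp j); apply: Hr jr.
have cj : 0 < c j by rewrite /c exprn_gt0.
have /andP[S1 S2] := HS j; have /andP[T1 T2] := HT j.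
exists ((S - (p j).1) / c j), ((T - (p j).2) / c j); split.
- rewrite divr_ge0 ?subr_ge0 //= ?(ltW cj) // ler_pdivrMr // mul1r; rewrite -/(c j) in S2; lra.
- rewrite divr_ge0 ?subr_ge0 //= ?(ltW cj) // ler_pdivrMr // mul1r; rewrite -/(c j) in T2; lra.
rewrite /w /corner /side !realCM !realCV !realCB.
have cC : (c j)%:C%C != 0 :> R[i].
  by apply: contra_neq (lt0r_neq0 cj) => /complexI.
by field.
Qed.

Lemma square_small_null k z d :
  (forall eta, 0 < eta -> square_small eta k z d) -> square_null k z d.
Proof.
move=> H e e0; have d0 := sqr_ge0 (normc d).
have [|N HN] := H (e / (normc d ^+ 2 + 1)); first by rewrite divr_gt0 //; lra.
exists N => M NM; apply: (le_trans (HN _ NM)).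
by rewrite -mulrA ger_pMr // mulrC ler_pdivrMr; lra.
Qed.

Lemma goursat k z d :
  (forall w, closed_square z d w -> cderivable k w) -> square_null k z d.
Proof. by move=> kd; apply: square_small_null => eta eta0; exact: goursat_small. Qed.

End Goursat.

(** * Isolated exceptional points *)
Section Exceptional.
Variable R : realType.
Implicit Types (k f : R[i] -> R[i]) (z d w : R[i]).

Definition locally_bounded k w := exists B r : R,
  0 < r /\ forall w', normc (w' - w) < r -> normc (k w') <= B.

Lemma closed_square_double z h (a b : R) w : 0 <= a <= 1 -> 0 <= b <= 1 ->
  closed_square (z + (a%:C%C + 'i%C * b%:C%C) * h) h w -> closed_square z (h + h) w.
Proof.
move=> a01 b01 [s [t [s01 t01 ->]]]; exists ((a + s) / 2), ((b + t) / 2).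
split; [by lra|by lra|].
have hf (x y : R) : ((x + y) / 2)%:C%C = (x%:C%C + y%:C%C) / 2 :> R[i].
  by rewrite realCM realCV (rmorphD (real_complex R)) (realCn _ 2).
by rewrite !hf; field.
Qed.

Lemma closed_square_double4 z h (Q : R[i] -> Prop) :
  (forall w, closed_square z (h + h) w -> Q w) ->
  [/\ forall w, closed_square z h w -> Q w,
      forall w, closed_square (z + h) h w -> Q w,
      forall w, closed_square (z + 'i%C * h) h w -> Q w &
      forall w, closed_square (z + h + 'i%C * h) h w -> Q w].
Proof.
move=> H; have i0 : 0 <= (0 : R) <= (1 : R) by rewrite lexx ler01.
have i1 : 0 <= (1 : R) <= (1 : R) by rewrite lexx ler01.
split => w zw; apply: H.
- apply: (closed_square_double i0 i0); rewrite (realCn _ 0).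
  by rewrite (_ : z + _ = z) //; ring.
- apply: (closed_square_double i1 i0); rewrite (realCn _ 0) (realCn _ 1).
  by rewrite (_ : z + _ = z + h) //; ring.
- apply: (closed_square_double i0 i1); rewrite (realCn _ 0) (realCn _ 1).
  by rewrite (_ : z + _ = z + 'i%C * h) //; ring.
- apply: (closed_square_double i1 i1); rewrite (realCn _ 1).
  by rewrite (_ : z + _ = z + h + 'i%C * h) //; ring.
Qed.

Lemma square_sum0 k N z : square_sum k N z 0 = 0.
Proof. by rewrite /square_sum /edge_sum mulr0 !mul0r !mulr0; ring. Qed.

Lemma closed_square_neq z h w (a b : R) : h != 0 -> 0 <= a -> 0 <= b -> a + b > 0 ->
  closed_square (z + (a%:C%C + 'i%C * b%:C%C) * h) h w -> w <> z.
Proof.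
move=> h0 a0 b0 ab [s [t [s01 t01 ->]]].
have -> : z + (a%:C%C + 'i%C * b%:C%C) * h + (s%:C%C + 'i%C * t%:C%C) * h =
    z + ((a + s) +i* (b + t))%C * h.
  have -> : ((a + s) +i* (b + t))%C = (a + s)%:C%C + 'i%C * (b + t)%:C%C :> R[i].
    by simpc.
  by rewrite !(rmorphD (real_complex R)) /=; ring.
move=> E; have /eqP : ((a + s) +i* (b + t))%C * h = 0.
  by apply: (addrI z); rewrite addr0.
rewrite mulf_eq0 (negPf h0) orbF.
rewrite eq_complex /= => /andP[/eqP as0 /eqP bt0]; lra.
Qed.

(** Quarter the square repeatedly: the three quarters away from the corner [z]
    have sums tending to 0, and the remaining one has a sum bounded by a multiple
    of its side, as [k] is bounded near [z]. *)
Lemma square_null_corner k z d :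
  (forall w, closed_square z d w -> w <> z -> cderivable k w) -> locally_bounded k z ->
  square_null k z d.
Proof.
move=> kd [B [r [r0 kB]]].
have main j : forall d, (forall w, closed_square z d w -> w <> z -> cderivable k w) ->
    2 * normc d * 2^-1 ^+ j < r -> forall e : R, 0 < e -> exists N0, forall N,
    (N0 <= N)%N ->
    normc (square_sum k (2 ^ N) z d) <= e + 4 * B * normc d * 2^-1 ^+ j.
  elim: j => [|j IH] {kd}d kd.
    rewrite expr0 !mulr1 => dr e e0; exists 0%N => N _.
    apply: (@le_trans _ _ (4 * B * normc d)); last by lra.
    apply: square_sum_bound => w /square_boundary_closed_square zw; apply: kB.
    exact: le_lt_trans (closed_square_diam (closed_square_corner z d) zw) dr.
  have [h dE] : exists h, d = h + h by exists (d / 2); field.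
  move: kd; rewrite {}dE => kd.
  have dh : normc (h + h) = 2 * normc h.
    by have -> : h + h = 2%:R * h by [ring]; rewrite normcM normc_nat.
  rewrite dh exprS => dr e e0.
  have [h0|h0] := eqVneq h 0.
    exists 0%N => N _; rewrite h0 addr0 square_sum0 normc0.
    by rewrite !(mulr0, mul0r) addr0 ltW.
  have e4 : 0 < e / 4 by rewrite divr_gt0.
  have [k1 k2 k3 k4] := closed_square_double4 kd.
  have [|N1 H1] := IH h k1 _ _ e4; first by lra.
  have [|N2 H2] := @goursat _ k (z + h) h _ _ e4.
    move=> w zw; apply: k2 => //.
    apply: (@closed_square_neq z h w 1 0 h0 ler01 (lexx 0)); first by rewrite addr0 ltr01.
    by rewrite (realCn _ 0) (realCn _ 1) (_ : z + _ = z + h) //; ring.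
  have [|N3 H3] := @goursat _ k (z + 'i%C * h) h _ _ e4.
    move=> w zw; apply: k3 => //.
    apply: (@closed_square_neq z h w 0 1 h0 (lexx 0) ler01); first by rewrite add0r ltr01.
    by rewrite (realCn _ 0) (realCn _ 1) (_ : z + _ = z + 'i%C * h) //; ring.
  have [|N4 H4] := @goursat _ k (z + h + 'i%C * h) h _ _ e4.
    move=> w zw; apply: k4 => //.
    apply: (@closed_square_neq z h w 1 1 h0 ler01 ler01); first by rewrite addr_gt0 ?ltr01.
    by rewrite (realCn _ 1) (_ : z + _ = z + h + 'i%C * h) //; ring.
  exists (N1 + N2 + N3 + N4).+1 => -[//|N]; rewrite ltnS => leN.
  rewrite square_sum_double_exp.
  have {}H1 := H1 N ltac:(lia). have {}H2 := H2 N ltac:(lia).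
  have {}H3 := H3 N ltac:(lia). have {}H4 := H4 N ltac:(lia).
  apply: (le_trans (normc_triangle _ _)).
  have := normc_triangle (square_sum k (2 ^ N) z h + square_sum k (2 ^ N) (z + h) h)
    (square_sum k (2 ^ N) (z + 'i%C * h) h).
  have := normc_triangle (square_sum k (2 ^ N) z h) (square_sum k (2 ^ N) (z + h) h).
  by lra.
move=> e e0; have B0 : 0 <= B.
  by apply: (le_trans (normc_ge0 (k z))); apply: kB; rewrite subrr normc0.
have d0 := normc_ge0 d; have Bd := mulr_ge0 B0 d0.
pose x := Num.min (r / (2 * normc d + 1)) (e / 2 / (4 * B * normc d + 1)).
have [j] : exists j, 2^-1 ^+ j < x.
  by apply: half_exprn_small; rewrite lt_min !divr_gt0 //; lra.
rewrite lt_min => /andP[]; rewrite ltr_pdivlMr; last by lra.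
rewrite ltr_pdivlMr; last by lra.
move=> jr je.
have j0 : 0 <= 2^-1 ^+ j :> R by rewrite exprn_ge0.
have [|N HN] := main j d kd _ (e / 2) ltac:(by rewrite divr_gt0); first by lra.
by exists N => M /HN; lra.
Qed.

End Exceptional.

Section Lattice.
Variable R : realType.
Implicit Types (k f : R[i] -> R[i]) (z d w : R[i]).

Lemma closed_square_rot z d w : closed_square (z + d) ('i%C * d) w -> closed_square z d w.
Proof.
move=> [s [t [s01 t01 ->]]]; exists (1 - t), s; split; [by lra|by []|].
have ii : 'i%C * ('i%C * d) = - d by rewrite mulrA -expr2 sqr_i mulN1r.
have -> : (s%:C%C + 'i%C * t%:C%C) * ('i%C * d) =
  'i%C * s%:C%C * d + t%:C%C * ('i%C * ('i%C * d)) by ring.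
by rewrite ii realCB (realCn _ 1); ring.
Qed.

Lemma square_null_rot k z d : square_null k (z + d) ('i%C * d) -> square_null k z d.
Proof. by move=> H e /H [N HN]; exists N => M /HN; rewrite square_sum_rot. Qed.

(** The singularities of the Cauchy kernel used below.  They are at distance 2,
    so that a unit square contains at most one of them, and they are Gaussian
    integers, so that in a unit square of the lattice it is a corner. *)
Definition exceptional w := w = 0 \/ w = 2%:R.

Lemma closed_square1_Re_Im z w : closed_square z 1 w ->
  complex.Re z <= complex.Re w <= complex.Re z + 1 /\
  complex.Im z <= complex.Im w <= complex.Im z + 1.
Proof.
case: z => a b [s [t [s01 t01 ->]]]; rewrite mulr1.
have -> : s%:C%C + 'i%C * t%:C%C = (s +i* t)%C :> R[i] by simpc.
by rewrite /=; lra.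
Qed.

Lemma exceptionalE w : exceptional w ->
  exists2 m : int, m = 0 \/ m = 2 & w = (m%:~R +i* 0)%C.
Proof.
case=> ->; [exists 0 => //; by left|exists 2; first by right].
by rewrite -(realCn _ 2).
Qed.

(** Either no exceptional point lies in the square, and [goursat] applies, or
    one of them is a corner, and rotating the square brings it to the base
    corner. *)
Lemma square_null_unit k (p q : int) (z := (p%:~R +i* q%:~R)%C : R[i]) :
  (forall w, closed_square z 1 w -> ~ exceptional w -> cderivable k w) ->
  (forall w, exceptional w -> locally_bounded k w) -> square_null k z 1.
Proof.
move=> kd kb.
have at_corner d w : exceptional w ->
    (forall w', closed_square w d w' -> closed_square z 1 w') -> square_null k w d.
  move=> ew sub; apply: square_null_corner; last exact: kb.
  move=> w' ww' neq; apply: kd; first exact: sub.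
  move=> ew'; apply: neq.
  have [] := closed_square1_Re_Im (sub _ ww').
  have [] := closed_square1_Re_Im (sub _ (closed_square_corner w d)).
  have [m m02 ->] := exceptionalE ew; have [m' m02' ->] := exceptionalE ew'.
  rewrite /= -[1]/(1%:~R) -!intrD !ler_int => h1 _ h2 _.
  suff -> : m = m' by [].
  by case: m02 h1 => ->; case: m02' h2 => ->; lia.
have [[w [zw ew]]|none] := pselect (exists w, closed_square z 1 w /\ exceptional w);
    last first.
  by apply: goursat => w zw; apply: kd => // ew; apply: none; exists w.
have [m _ wE] := exceptionalE ew.
have [] := closed_square1_Re_Im zw; rewrite wE /= -[1]/(1%:~R) -!intrD -[0]/(0%:~R).
rewrite !ler_int => hm hq.
have r1 := @closed_square_rot z 1.
have r2 := @closed_square_rot (z + 1) ('i%C * 1).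
have r3 := @closed_square_rot (z + 1 + 'i%C * 1) ('i%C * ('i%C * 1)).
have ii : 'i%C * ('i%C * 1) = - 1 :> R[i] by rewrite mulrA -expr2 sqr_i mulN1r.
have [hp|hp] : m = p \/ m = p + 1 by lia.
  have [q0|q0] : q = 0 \/ q = -1 by lia.
    have -> : z = w by rewrite wE hp /z q0.
    by apply: at_corner => //; rewrite wE hp /z q0.
  do 3 apply: square_null_rot; apply: at_corner.
    rewrite ii (_ : _ + _ = w) // wE hp /z q0; simpc.
    by rewrite addrK mulrNz addNr.
  by move=> w' /r3 /r2 /r1.
have [q0|q0] : q = 0 \/ q = -1 by lia.
  apply: square_null_rot; apply: at_corner; last by move=> w' /r1.
  by rewrite (_ : _ + _ = w) // wE hp /z q0 intrD; simpc.
do 2 apply: square_null_rot; apply: at_corner; last by move=> w' /r2 /r1.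
rewrite (_ : _ + _ = w) // wE hp /z q0 intrD; simpc.
by rewrite mulrNz addNr.
Qed.

(** Squares of the Gaussian lattice with side a power of 2 are assembled from
    unit squares. *)
Lemma square_null_lattice k j (p q : int) :
  (forall w, exceptional w -> locally_bounded k w) ->
  (forall w, closed_square (p%:~R +i* q%:~R)%C (2 ^+ j) w -> ~ exceptional w ->
    cderivable k w) ->
  square_null k (p%:~R +i* q%:~R)%C (2 ^+ j).
Proof.
move=> kb; elim: j p q => [|j IH] p q.
  by move=> kd; exact: square_null_unit.
set z := (p%:~R +i* q%:~R)%C.
have -> : 2 ^+ j.+1 = 2 ^+ j + 2 ^+ j :> R[i] by rewrite exprS; ring.
move=> kd; have [k1 k2 k3 k4] := closed_square_double4 kd.
have zr : z + 2 ^+ j = ((p + 2 ^+ j)%:~R +i* q%:~R)%C.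
  have -> : 2 ^+ j = ((2 ^+ j : int)%:~R +i* 0)%C :> R[i].
    rewrite rmorphXn /= complexr0 -(realCn _ 2).
    by symmetry; exact: (rmorphXn (real_complex R)).
  by rewrite /z; simpc; rewrite intrD.
have zu (a b : R) : (a +i* b)%C + 'i%C * 2 ^+ j = (a +i* (b + (2 ^+ j : int)%:~R))%C.
  have -> : 2 ^+ j = ((2 ^+ j : int)%:~R +i* 0)%C :> R[i].
    rewrite rmorphXn /= complexr0 -(realCn _ 2).
    by symmetry; exact: (rmorphXn (real_complex R)).
  by simpc.
apply: square_null_double; first exact: IH.
- by move: k2; rewrite zr; exact: IH.
- by move: k3; rewrite zu -intrD; exact: IH.
- by move: k4; rewrite zr zu -intrD; exact: IH.
Qed.

End Lattice.

(** * The Cauchy kernel *)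
Section Derivable.
Variable K : numFieldType.
Implicit Types (f : K -> K) (w : K).

Lemma derivable_expansion f w : derivable f w 1 <->
  exists L, forall e, 0 < e -> exists2 r, 0 < r & forall w', `|w' - w| < r ->
    `|f w' - f w - L * (w' - w)| <= e * `|w' - w|.
Proof.
split=> [/cvg_ex[/= L /cvgrPdist_le HL]|[L HL]].
  exists L => e e0; have := HL e e0.
  rewrite near_withinE => /nbhs_norm0P[r /= r0 Hr]; exists r => // w' rw'.
  have [->|neq] := eqVneq w' w; first by rewrite !subrr mulr0 subrr !normr0 mulr0.
  have d0 : w' - w != 0 by rewrite subr_eq0.
  have := Hr (w' - w) rw' d0; rewrite scaler1 subrK => H.
  have -> : f w' - f w - L * (w' - w) =
      - ((L - (w' - w)^-1 *: (f w' - f w)) * (w' - w)).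
    by rewrite /GRing.scale /=; field.
  by rewrite normrN normrM ler_wpM2r.
apply/cvg_ex; exists L; apply/cvgrPdist_le => e e0.
have [r r0 Hr] := HL e e0.
near=> h.
have hr : `|h| < r by near: h; exact: dnbhs0_lt.
have h0 : h != 0 by near: h; exact: nbhs_dnbhs_neq.
have := Hr (h *: 1 + w); rewrite addrK scaler1 => /(_ hr) H.
have -> : L - h^-1 *: (f (h + w) - f w) = - (h^-1 * (f (h + w) - f w - L * h)).
  by rewrite /GRing.scale /=; field.
rewrite normrN normrM normfV ler_pdivrMl ?normr_gt0 //. by rewrite [X in _ <= X]mulrC.
Unshelve. all: by end_near. Qed.

Lemma derivable_cauchy_kernel f a c w : derivable f w 1 -> w != 0 -> w != a ->
  derivable (fun x => (f x / x - c) / (x - a)) w 1.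
Proof.
move=> fw w0 wa; apply: derivableM; last first.
  apply: derivableV; first by rewrite subr_eq0.
  by apply: derivableB; [exact: derivable_id|exact: derivable_cst].
apply: derivableB; last exact: derivable_cst.
by apply: derivableM => //; apply: derivableV => //; exact: derivable_id.
Qed.

End Derivable.

Section Schwarz.
Variable R : realType.
Implicit Types (k f : R[i] -> R[i]) (z d w : R[i]).

Lemma normE (x : R[i]) : `|x| = (normc x)%:C%C.
Proof. by case: x. Qed.

Lemma realC_lt (x y : R) : (x%:C%C < y%:C%C :> R[i]) = (x < y).
Proof. exact: ltcR. Qed.

Lemma realC_le (x y : R) : (x%:C%C <= y%:C%C :> R[i]) = (x <= y).
Proof. exact: lecR. Qed.

Lemma realC_pos (e : R[i]) : 0 < e -> exists2 r : R, 0 < r & e = r%:C%C.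
Proof.
by case: e => a b; rewrite ltcE /= => /andP[/eqP -> a0]; exists a.
Qed.

(** Products and quotients are differentiated on the side of [derivable]. *)
Lemma cderivableE f w : cderivable f w <-> derivable (f : R[i]^o -> R[i]^o) w 1.
Proof.
split=> [[L HL]|/derivable_expansion[L HL]].
  apply/derivable_expansion; exists L => e /realC_pos[e' e'0 ->].
  have [r r0 Hr] := HL _ e'0.
  exists r%:C%C; first by rewrite -[0]/(0%:C%C) realC_lt.
  by move=> w'; rewrite !normE realC_lt -realCM realC_le; exact: Hr.
exists L => e e0.
have [|r /realC_pos[r' r'0 ->] Hr] := HL e%:C%C.
  by rewrite -[0]/(0%:C%C) realC_lt.
exists r' => // w' rw'; rewrite -realC_le realCM -!normE; apply: Hr.
by rewrite normE realC_lt.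
Qed.

(** For [c = f 2 / 2] and [f 0 = 0] the kernel is bounded near 0 and near 2: it
    is the difference quotient at 2 of the function [f w / w], which in turn is
    the difference quotient of [f] at 0. *)
Definition cauchy_kernel f c w := (f w / w - c) / (w - 2%:R).

Lemma cderivable_cauchy_kernel f c w : cderivable f w -> ~ exceptional w ->
  cderivable (cauchy_kernel f c) w.
Proof.
move=> /cderivableE fw ew; apply/cderivableE; apply: derivable_cauchy_kernel fw _ _.
  by apply/eqP => w0; apply: ew; left.
by apply/eqP => w0; apply: ew; right.
Qed.

Lemma cderivable_lipschitz f w : cderivable f w -> exists B r : R,
  [/\ 0 <= B, 0 < r & forall w', normc (w' - w) < r ->
    normc (f w' - f w) <= B * normc (w' - w)].
Proof.
move=> [L /(_ _ ltr01)[r r0 Hr]]; exists (normc L + 1), r; split => //.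
  by rewrite addr_ge0 ?normc_ge0.
move=> w' /Hr; have := normc_triangle (f w' - f w - L * (w' - w)) (L * (w' - w)).
by rewrite subrK normcM; lra.
Qed.

Lemma cauchy_kernel_bounded f w :
  cderivable f 0 -> cderivable f 2%:R -> f 0 = 0 -> exceptional w ->
  locally_bounded (cauchy_kernel f (f 2%:R / 2%:R)) w.
Proof.
move=> f0 f2 f00; set c := f 2%:R / 2%:R.
have n2 : normc (2%:R : R[i]) = 2 by rewrite normc_nat.
case=> ->.
  have [B [r [B0 r0 Hr]]] := cderivable_lipschitz f0.
  exists (B + normc c), (Num.min r 1); split; first by rewrite lt_min r0 ltr01.
  move=> w'; rewrite subr0 lt_min => /andP[w'r w'1].
  rewrite /cauchy_kernel normcM normcV.
  have h2 : 1 <= normc (w' - 2%:R).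
    have := normc_triangleB w' (w' - 2%:R).
    by rewrite opprB addrC subrK n2; lra.
  rewrite ler_pdivrMr; last by lra.
  have h1 : normc (f w' / w') <= B.
    have [->|w'0] := eqVneq w' 0; first by rewrite f00 mul0r normc0.
    have p : 0 < normc w'.
      by rewrite lt0r normc_ge0 andbT; apply: contra_neq w'0 => /eq0_normc.
    rewrite normcM normcV ler_pdivrMr //.
    by have := Hr w'; rewrite subr0 f00 subr0; exact.
  have := normc_triangleB (f w' / w') c; have := normc_ge0 c; nra.
have [B [r [B0 r0 Hr]]] := cderivable_lipschitz f2.
exists (B + normc c), (Num.min r 1); split; first by rewrite lt_min r0 ltr01.
move=> w'; rewrite lt_min => /andP[w'r w'1].
have [->|neq] := eqVneq w' 2%:R.
  by rewrite /cauchy_kernel -/c subrr mul0r normc0 addr_ge0 ?normc_ge0.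
have h1 : 1 <= normc w'.
  have := normc_triangleB w' (w' - 2%:R).
  by rewrite opprB addrC subrK n2; lra.
have w'0 : w' != 0 by apply/eqP => w0; move: h1; rewrite w0 normc0; lra.
have d0 : w' - 2%:R != 0 by rewrite subr_eq0.
have -> : cauchy_kernel f c w' =
    ((f w' - f 2%:R) / (w' - 2%:R) - c) / w'.
  by rewrite /cauchy_kernel /c; field; rewrite w'0 d0.
rewrite normcM normcV ler_pdivrMr; last by lra.
have h3 : normc ((f w' - f 2%:R) / (w' - 2%:R)) <= B.
  have p : 0 < normc (w' - 2%:R).
    by rewrite lt0r normc_ge0 andbT; apply: contra_neq d0 => /eq0_normc.
  by rewrite normcM normcV ler_pdivrMr //; exact: Hr.
have := normc_triangleB ((f w' - f 2%:R) / (w' - 2%:R)) c.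
by have := normc_ge0 c; nra.
Qed.

End Schwarz.

(** * Schwarz lemma on a square *)
Section SchwarzSquare.
Variable R : realType.
Implicit Types (k f : R[i] -> R[i]) (z d w : R[i]).

(** The form dw / w is invariant under complex scalings, and the midpoint sums
    inherit this. *)
Lemma edge_sum_inv_scale u N z d : u != 0 ->
  edge_sum (fun w => w^-1) N (u * z) (u * d) = edge_sum (fun w => w^-1) N z d.
Proof.
move=> u0; rewrite /edge_sum !mulr_suml; apply: eq_bigr => i _.
rewrite [_ * (u * d)]mulrCA -mulrDr invfM -mulrA.
by rewrite mulrACA mulVf // mul1r.
Qed.

(** The hypothesis says that the square is centered at 0; multiplication by i
    then permutes its edges. *)
Lemma square_sum_inv N z d : 'i%C * z = z + d ->
  square_sum (fun w => w^-1) N z d = 4%:R * edge_sum (fun w => w^-1) N z d.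
Proof.
move=> izd; rewrite /square_sum; set E := edge_sum _ N z d.
have i0 : 'i%C != 0 :> R[i].
  by apply/eqP => /(congr1 (@normc R)); rewrite normc_i normc0 => /eqP; rewrite oner_eq0.
have ii : 'i%C * 'i%C = -1 :> R[i] by rewrite -expr2 sqr_i.
have dE : d = 'i%C * z - z by rewrite izd addrC addKr.
have iid : z + 'i%C * d = - ('i%C * z).
  by rewrite dE mulrBr mulrA ii; ring.
have -> : edge_sum (fun w => w^-1) N (z + d) ('i%C * d) = E.
  by rewrite -izd edge_sum_inv_scale.
have -> : edge_sum (fun w => w^-1) N (z + 'i%C * d) d = - E.
  rewrite iid -[LHS]opprK -edge_sum_rev; congr (- _).
  have -> : - ('i%C * z) + d = -1 * z by rewrite dE; ring.
  have -> : - d = -1 * d by rewrite mulN1r.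
  by rewrite edge_sum_inv_scale // oppr_eq0 oner_eq0.
have -> : edge_sum (fun w => w^-1) N z ('i%C * d) = - E.
  rewrite -[LHS]opprK -edge_sum_rev iid; congr (- _).
  by rewrite -!mulNr edge_sum_inv_scale // oppr_eq0.
by ring.
Qed.

Lemma ImD (x y : R[i]) : complex.Im (x + y) = complex.Im x + complex.Im y.
Proof. by case: x y => a b []. Qed.

Lemma ImMr (x : R[i]) (r : R) : complex.Im (x * r%:C%C) = complex.Im x * r.
Proof. by case: x => a b /=; rewrite mulr0 add0r. Qed.

Lemma Im_edge_sum_inv N z d (x : R) : (0 < N)%N ->
  (forall s : R, 0 <= s <= 1 -> x <= complex.Im ((z + s%:C%C * d)^-1 * d)) ->
  x <= complex.Im (edge_sum (fun w => w^-1) N z d).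
Proof.
move=> N0 H; have NR : 0 < N%:R :> R by rewrite ltr0n.
rewrite /edge_sum mulrA mulr_suml -(realCn _ N) -realCV ImMr ler_pdivlMr //.
apply: (@le_trans _ _ (\sum_(i < N) complex.Im ((z + (node R N i)%:C%C * d)^-1 * d))).
  rewrite mulr_natr -[X in x *+ X](card_ord N) -sumr_const.
  by apply: ler_sum => i _; apply/H/node_itv.
elim/big_ind2 : _ => //= a b a' b' h1 h2; rewrite ImD; exact: lerD.
Qed.

(** The exact integral is 2 i pi.  On the lower edge the imaginary part of
    2 l / w is at least 1 at every point, which bounds the sum below without
    evaluating it. *)
Lemma square_sum_inv_ge (l : R) N : 0 < l -> (0 < N)%N ->
  4 <= normc (square_sum (fun w => w^-1) N ((- l) +i* (- l))%C (2 * l)%:C%C).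
Proof.
move=> l0 N0; rewrite square_sum_inv; last by simpc; congr (_ +i* _)%C; ring.
rewrite normcM normc_nat.
suff : 1 <= complex.Im (edge_sum (fun w => w^-1) N ((- l) +i* (- l))%C (2 * l)%:C%C).
  move=> h; rewrite -[X in X <= _]mulr1 ler_wpM2l //.
  by apply: (le_trans h); apply: le_trans (abs_Im_le_normc _); rewrite ler_norm.
apply: Im_edge_sum_inv => // s s01; rewrite ImMr.
have -> : ((- l) +i* (- l))%C + s%:C%C * (2 * l)%:C%C =
    (l * (2 * s - 1) +i* (- l))%C by simpc; congr (_ +i* _)%C; ring.
have D0 : 0 < (l * (2 * s - 1)) ^+ 2 + (- l) ^+ 2.
  by rewrite sqrrN ltr_wpDl ?sqr_ge0 // exprn_gt0.
rewrite /= -mulNr opprK mulrAC ler_pdivlMr //.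
have : (l * (2 * s - 1)) ^+ 2 <= l ^+ 2.
  rewrite exprMn ger_pMr ?exprn_gt0 //.
  have : (2 * s - 1) * (2 * s - 1) <= 1 by nra.
  by rewrite expr2.
by rewrite sqrrN !expr2; nra.
Qed.

Lemma square_boundary_norm (l : R) w : 0 < l ->
  square_boundary ((- l) +i* (- l))%C (2 * l)%:C%C w -> l <= normc w.
Proof.
move=> l0 [s s01 [] ->].
- apply: le_trans (abs_Im_le_normc _); simpc.
  by rewrite /= normrN ler_norm.
- apply: le_trans (abs_Re_le_normc _); simpc => /=.
  by apply: le_trans (ler_norm _); lra.
- apply: le_trans (abs_Im_le_normc _); simpc => /=.
  by apply: le_trans (ler_norm _); lra.
- apply: le_trans (abs_Re_le_normc _); simpc => /=.
  by rewrite normrN ler_norm.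
Qed.

(** With [c = f 2 / 2], the midpoint sums of the Cauchy kernel are those of
    f / (w (w - 2)), of modulus at most 8 A / (l - 2), minus [c] times those of
    1 / (w - 2), of modulus at least 2.  As the sums of the kernel tend to 0, the
    modulus of [c] is at most 4 A / (l - 2). *)
Lemma schwarz_square f (A : R) (j : nat) (l := 2 ^+ j : R) : (4 <= j)%N ->
  (forall w, closed_square ((- l) +i* (- l))%C (2 * l)%:C%C w ->
    cderivable f w /\ normc (f w) <= A) ->
  f 0 = 0 -> normc (f 2%:R) <= 16 * A / l.
Proof.
move=> j4 fA f0.
have l16 : 16 <= l.
  rewrite (_ : 16 = 2 ^+ 4); last by ring.
  by rewrite /l ler_weXn2l // ler1n.
have l0 : 0 < l by lra.
set z := ((- l) +i* (- l))%C; set d := (2 * l)%:C%C.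
have zint : z = ((- (2 ^+ j))%:~R +i* (- (2 ^+ j))%:~R)%C.
  by rewrite /z rmorphN /= rmorphXn.
have dexp : d = 2 ^+ j.+1.
  rewrite /d /l -exprS -(realCn _ 2); exact: (rmorphXn (real_complex R)).
have inside (m : R) : 0 <= m <= 2 -> closed_square z d m%:C%C.
  move=> m2; exists ((l + m) / (2 * l)), (2^-1); split; last first.
  - rewrite /z /d; simpc; congr (_ +i* _)%C; field=> //; exact: lt0r_neq0.
  - by rewrite invr_ge0 ler0n /= invf_le1 // ler1n.
  - by rewrite divr_ge0 ?ler_pdivrMr //=; lra.
have z0 : closed_square z d 0 by have := inside 0; rewrite (realCn _ 0); apply; lra.
have z2 : closed_square z d 2%:R by have := inside 2; rewrite (realCn _ 2); apply; lra.
have A0 : 0 <= A by have [_] := fA _ z0; exact/le_trans/normc_ge0.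
pose c := f 2%:R / 2%:R; pose k := cauchy_kernel f c.
have knull : square_null k z d.
  rewrite zint dexp; apply: square_null_lattice.
    by move=> w ew; apply: cauchy_kernel_bounded => //; [case: (fA _ z0)|case: (fA _ z2)].
  rewrite -zint -dexp => w zw ew; apply: cderivable_cauchy_kernel => //.
  by case: (fA _ zw).
have bd w : square_boundary z d w ->
    [/\ l <= normc w, l - 2 <= normc (w - 2%:R) & normc (f w) <= A].
  move=> zw; have lw := square_boundary_norm l0 zw; split => //.
    by have := normc_subl w 2%:R; rewrite normc_nat; lra.
  by case: (fA _ (square_boundary_closed_square zw)).
have nd : normc d = 2 * l by rewrite normc_real ger0_norm //; lra.
have l2 : 0 < l - 2 by lra.
have main (e : R) : 0 < e -> 2 * normc c <= 8 * A / (l - 2) + e.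
  move=> e0; have [N HN] := knull e e0; have {HN} := HN N (leqnn N).
  have N0 : (0 < 2 ^ N)%N by rewrite expn_gt0.
  set M := (2 ^ N)%N in N0 *.
  pose k1 w := f w / w / (w - 2%:R).
  pose k2 w := w^-1 : R[i].
  pose k3 w := (w - 2%:R)^-1 - w^-1 : R[i].
  (* 1 / (w - 2) is compared with 1 / w, whose sums are bounded below. *)
  have -> : k = fun w => k1 w + (- c) * (k2 w + k3 w).
    by apply/funext => w; rewrite /k /cauchy_kernel /k1 /k2 /k3; ring.
  rewrite square_sumD square_sumZ square_sumD.
  have b1 : normc (square_sum k1 M z d) <= 8 * A / (l - 2).
    apply: (@le_trans _ _ (4 * (A / (l * (l - 2))) * normc d)).
      apply: square_sum_bound => w /bd[w1 w2 w3].
      rewrite /k1 !normcM !normcV -mulrA -invfM ler_pdivrMr ?mulr_gt0 //; try lra.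
      rewrite mulrAC ler_pdivlMr ?mulr_gt0 //.
      by apply: ler_pM => //; [exact: normc_ge0|nra|nra].
    rewrite nd le_eqVlt; apply/orP; left; apply/eqP; field.
    by rewrite !lt0r_neq0.
  have b3 : normc (square_sum k3 M z d) <= 16 / (l - 2).
    apply: (@le_trans _ _ (4 * (2 / (l * (l - 2))) * normc d)).
      apply: square_sum_bound => w /bd[w1 w2 w3].
      have w0 : w != 0 by apply/eqP => w0; move: w1; rewrite w0 normc0; lra.
      have w20 : w - 2%:R != 0 by apply/eqP => w20; move: w2; rewrite w20 normc0; lra.
      have -> : k3 w = 2%:R / (w * (w - 2%:R)) by rewrite /k3; field; rewrite w0 w20.
      rewrite normcM normcV normcM normc_nat ler_pdivrMr ?mulr_gt0 //; try lra.
      rewrite mulrAC ler_pdivlMr ?mulr_gt0 //.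
      by rewrite ler_wpM2l //; nra.
    rewrite nd le_eqVlt; apply/orP; left; apply/eqP; field.
    by rewrite !lt0r_neq0.
  have b2 : 4 <= normc (square_sum k2 M z d) by exact: square_sum_inv_ge.
  have b4 : 16 / (l - 2) <= 2 by rewrite ler_pdivrMr //; lra.
  have := normc_subl (square_sum k2 M z d) (- square_sum k3 M z d).
  rewrite opprK normc_opp => b5 bk.
  have := normc_triangleB (square_sum k1 M z d +
    - c * (square_sum k2 M z d + square_sum k3 M z d)) (square_sum k1 M z d).
  rewrite addrC addKr normcM normc_opp => b6.
  have c0 := normc_ge0 c.
  have : normc c * 2 <= normc c * normc (square_sum k2 M z d + square_sum k3 M z d).
    by rewrite ler_wpM2l //; lra.
  by lra.
have fc : normc (f 2%:R) = 2 * normc c.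
  by rewrite /c normcM normcV normc_nat; field.
rewrite fc; apply: (@le_trans _ _ (8 * A / (l - 2))).
  by apply/ler_addgt0Pr => e e0; exact: main.
rewrite ler_pdivrMr // mulrAC ler_pdivlMr //; nra.
Qed.

End SchwarzSquare.

(** * Differentiability and the Euclidean norm *)
Section Differentiable.
Variable K : numFieldType.

Lemma differentiable_line (V : normedModType K) (s : V -> K) (p v : V) (w : K) :
  differentiable s (p + w *: v) -> derivable (fun t : K => s (p + t *: v)) w 1.
Proof.
move=> /diff_derivable-/(_ v); rewrite /derivable.
set F := (F in cvg (F @ _) -> _); set G := (G in _ -> cvg (G @ _)).
suff -> : F = G by [].
apply/funext => h; rewrite /F /G /= /shift /= scaler1 scalerDl.
by rewrite addrCA.
Qed.

Lemma differentiable_lipschitz (V W : normedModType K) (f : V -> W) (x : V) :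
  differentiable f x -> exists C r : K, [/\ 0 <= C, 0 < r &
    forall y, `|y - x| < r -> `|f y - f x| <= C * `|y - x|].
Proof.
move=> df; have [/linear_lipschitz[C C0 HC] dfo] := (diff_locallyP x f).1 df.
have /eqaddoP/(_ 1 ltr01) H := dfo.
have := H; rewrite near_simpl => /nbhs_norm0P[r /= r0 Hr].
exists (C + 1), r; split=> //; first by rewrite addr_ge0 // ltW.
move=> y yx; have := Hr (y - x) yx; rewrite /= mul1r => {}Hr.
have -> : f y - f x = (f \o shift x - (cst (f x) + 'd f x)) (y - x) + 'd f x (y - x).
  by rewrite /= !fctE /= /shift subrK opprD addrA subrK.
rewrite mulrDl mul1r addrC; apply: (le_trans (ler_normD _ _)).
by apply: lerD.
Qed.

Lemma mx_entry_le m n (x : 'M[K]_(m, n)) i j : `|x i j| <= `|x|.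
Proof.
rewrite [leRHS]/Num.norm /= mx_normE; set M := \big[_/_]_i _.
have /bigmax_leP[_ H] : (M <= M)%O by [].
by have := H (i, j) isT; rewrite -num_le.
Qed.

Lemma mx_norm_le m n (x : 'M[K]_(m, n)) (e : K) : 0 <= e ->
  (forall i j, `|x i j| <= e) -> `|x| <= e.
Proof.
move=> e0 H; rewrite [leLHS]/Num.norm /=.
have [->//|/mx_norm_neq0[i ->]] := eqVneq (mx_norm x) 0.
exact: H.
Qed.

Lemma nbhs_normed (V : normedModType K) (x : V) (P : set V) :
  nbhs x P <-> exists2 r : K, 0 < r & forall y, `|y - x| < r -> P y.
Proof.
split=> [/nbhs_normP[r /= r0 Hr]|[r r0 Hr]].
  by exists r => // y xy; apply: Hr => /=; rewrite distrC.
by apply/nbhs_normP; exists r => //= y /= xy; apply: Hr; rewrite distrC.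
Qed.

End Differentiable.

Section EuclideanNorm.
Variables (R : realType) (n : nat).
Local Notation Cn := 'rV[R[i]]_n.
Implicit Types (v z w : Cn).

Lemma sqnormCE (x : R[i]) : sqnormC x = normc x ^+ 2.
Proof. by case: x => a b; rewrite /sqnormC /= sqr_sqrtr // addr_ge0 ?sqr_ge0. Qed.

Lemma sqnormC_ge0 (x : R[i]) : 0 <= sqnormC x.
Proof. by rewrite sqnormCE sqr_ge0. Qed.

Lemma sqnorm_ge0 v : 0 <= sqnorm v.
Proof. by apply: sumr_ge0 => j _; exact: sqnormC_ge0. Qed.

Lemma enorm_ge0 v : 0 <= enorm v.
Proof. exact: sqrtr_ge0. Qed.

Lemma normc_le_enorm v j : normc (v 0 j) <= enorm v.
Proof.
rewrite /enorm -[leLHS]ger0_norm ?normc_ge0 // -sqrtr_sqr ler_sqrt ?sqnorm_ge0 //.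
rewrite -sqnormCE /sqnorm (bigD1 j) //= lerDl.
by apply: sumr_ge0 => i _; exact: sqnormC_ge0.
Qed.

Lemma enorm_le v (M : R) : 0 <= M -> (forall j, normc (v 0 j) <= M) ->
  enorm v <= n%:R * M.
Proof.
move=> M0 H; rewrite /enorm -[leRHS]ger0_norm ?mulr_ge0 // -sqrtr_sqr.
rewrite ler_sqrt ?sqr_ge0 //.
apply: (@le_trans _ _ (\sum_(j < n) M ^+ 2)).
  by apply: ler_sum => j _; rewrite sqnormCE ler_pXn2r ?nnegrE ?normc_ge0.
rewrite sumr_const card_ord -[leLHS]mulr_natl exprMn ler_wpM2r ?sqr_ge0 //.
by case: (n) => [|p]; [rewrite expr0n|rewrite ler_eXnr // ler1n].
Qed.

Lemma enorm_eq0 v : enorm v = 0 -> v = 0.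
Proof.
move=> v0; apply/rowP => j; rewrite mxE; apply: eq0_normc.
by apply/eqP; rewrite eq_le normc_ge0 andbT -v0 normc_le_enorm.
Qed.

Lemma enorm_gt0 v : v != 0 -> 0 < enorm v.
Proof. by move=> v0; rewrite lt0r enorm_ge0 andbT; apply: contra_neq v0 => /enorm_eq0. Qed.

Lemma enorm0 : enorm (0 : Cn) = 0.
Proof.
rewrite /enorm /sqnorm big1 ?sqrtr0 // => j _.
by rewrite mxE sqnormCE normc0 expr0n.
Qed.

Lemma enormZ (c : R[i]) v : enorm (c *: v) = normc c * enorm v.
Proof.
rewrite /enorm -[normc c]ger0_norm ?normc_ge0 // -sqrtr_sqr -sqrtrM ?sqr_ge0 //.
congr Num.sqrt; rewrite /sqnorm mulr_sumr; apply: eq_bigr => j _.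
by rewrite !sqnormCE mxE normcM exprMn.
Qed.

Lemma norm_le_enorm v : `|v| <= (enorm v)%:C%C.
Proof.
apply: mx_norm_le => [|i j]; first by rewrite ler0c enorm_ge0.
by rewrite (ord1 i) normE realC_le normc_le_enorm.
Qed.

Lemma enorm_le_norm v : (enorm v)%:C%C <= n%:R * `|v|.
Proof.
have [r r0 nr] : exists2 r : R, 0 <= r & `|v| = r%:C%C.
  have : 0 <= `|v| by [].
  case: `|v| => a b; rewrite lecE /= => /andP[/eqP -> a0]; by exists a.
rewrite nr -(realCn _ n) -realCM realC_le; apply: enorm_le => // j.
by rewrite -realC_le -normE -nr mx_entry_le.
Qed.

Lemma nbhs_enorm z (P : set Cn) :
  nbhs z P <-> exists2 r : R, 0 < r & forall w, enorm (w - z) < r -> P w.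
Proof.
split=> [/(nbhs_normed (V := Cn))[r' /realC_pos[r r0 ->] Hr]|[r r0 Hr]].
  exists r => // w wz; apply: Hr; apply: (le_lt_trans (norm_le_enorm _)).
  by rewrite realC_lt.
apply/(nbhs_normed (V := Cn)); exists (r / n.+1%:R)%:C%C.
  by rewrite -[0]/(0%:C%C) realC_lt divr_gt0.
move=> w wz; apply: Hr; rewrite -realC_lt; apply: (le_lt_trans (enorm_le_norm _)).
apply: (@le_lt_trans _ _ (n.+1%:R * `|w - z|)).
  by rewrite ler_wpM2r // ler_nat.
have -> : r%:C%C = n.+1%:R * (r / n.+1%:R)%:C%C :> R[i].
  by rewrite -(realCn _ n.+1) -realCM mulrC divfK ?pnatr_eq0.
by rewrite ltr_pM2l ?ltr0n.
Qed.

(** Lelong numbers and boundedness are compared between two charts through this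
    bound on the change of coordinates. *)
Lemma differentiable_enorm_lipschitz (f : Cn -> Cn) z :
  differentiable f z -> exists C r : R, [/\ 0 <= C, 0 < r &
    forall w, enorm (w - z) < r -> enorm (f w - f z) <= C * enorm (w - z)].
Proof.
move=> /differentiable_lipschitz[C' [r' [C0 /realC_pos[r r0 ->] H]]].
have [C C0' C'E] : exists2 C : R, 0 <= C & C' = C%:C%C.
  by case: C' C0 {H} => a b; rewrite lecE /= => /andP[/eqP -> a0]; exists a.
exists (n%:R * C), r; split => //; first by rewrite mulr_ge0.
move=> w wz; rewrite -realC_le !realCM (realCn _ n).
apply: (le_trans (enorm_le_norm _)); rewrite -mulrA ler_wpM2l //.
apply: (@le_trans _ _ (C' * `|w - z|)).
  by apply: H; apply: (le_lt_trans (norm_le_enorm _)); rewrite realC_lt.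
by rewrite C'E ler_wpM2l ?norm_le_enorm // ler0c.
Qed.

Lemma cderivable_line (s : Cn -> R[i]) (p v : Cn) (t : R[i]) :
  differentiable s (p + t *: v) -> cderivable (fun u => s (p + u *: v)) t.
Proof. by move=> /differentiable_line ds; apply/cderivableE. Qed.

End EuclideanNorm.

(** * Schwarz lemma for finite families *)
Section SchwarzFamily.

Lemma differentiable_lin_comb (K : numFieldType) (V : normedModType K)
    (I : eqType) (r : seq I) (c : I -> K) (s : I -> V -> K) (x : V) :
  (forall i, i \in r -> differentiable (s i) x) ->
  differentiable (fun w => \sum_(i <- r) c i * s i w) x.
Proof.
elim: r => [|i r IH] H.
  rewrite (_ : (fun _ => _) = cst 0); first exact: differentiable_cst.
  by apply/funext => w; rewrite big_nil.
rewrite (_ : (fun _ => _) =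
    (fun w => c i *: (s i w : K^o)) + (fun w => \sum_(i <- r) c i * s i w)).
  apply: differentiableD; last by apply: IH => j jr; apply: H; rewrite in_cons jr orbT.
  by apply: differentiableZ; apply: H; rewrite mem_head.
by apply/funext => w; rewrite big_cons fctE.
Qed.

Variables (R : realType) (n : nat).
Local Notation Cn := 'rV[R[i]]_n.

Lemma normc_conjc (x : R[i]) : normc (conjc x) = normc x.
Proof. by case: x => a b /=; rewrite sqrrN. Qed.

Lemma conjc_mul_self (x : R[i]) : conjc x * x = (sqnormC x)%:C%C.
Proof. by case: x => a b; rewrite /sqnormC; simpc; congr (_ +i* _)%C; ring. Qed.

Lemma closed_square_centered (l : R) (w : R[i]) :
  closed_square ((- l) +i* (- l))%C (2 * l)%:C%C w -> 0 <= l -> normc w <= 2 * l.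
Proof.
move=> [s [t [s01 t01 ->]]] l0.
have -> : ((- l) +i* (- l))%C + (s%:C%C + 'i%C * t%:C%C) * (2 * l)%:C%C =
    (l * (2 * s - 1))%:C%C + 'i%C * (l * (2 * t - 1))%:C%C.
  by simpc; congr (_ +i* _)%C; ring.
apply: (le_trans (normc_le_abs _ _)); rewrite !normrM [`|l|]ger0_norm //.
have : `|2 * s - 1| <= 1 by rewrite ler_norml; lra.
have : `|2 * t - 1| <= 1 by rewrite ler_norml; lra.
by nra.
Qed.

(** The half side of a square of the lattice must be a power of 2. *)
Lemma dyadic_scale (x : R) : 64 < x -> exists2 j, (4 <= j)%N & 2 ^+ j < x <= 2 * 2 ^+ j.
Proof.
move=> x64; have x0 : 0 < x by lra.
have ex : exists j, x <= 2 ^+ j.+1.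
  have [j Hj] : exists j, 2^-1 ^+ j < x^-1.
    by apply: half_exprn_small; rewrite invr_gt0.
  exists j; rewrite exprS; apply: (@le_trans _ _ (2 ^+ j)); last first.
    by have : 0 <= 2 ^+ j :> R by [rewrite exprn_ge0]; lra.
  by apply/ltW; move: Hj; rewrite exprVn ltf_pV2 ?posrE ?exprn_gt0.
case: (ex_minnP ex) => j Hj minj; exists j; last first.
  rewrite -exprS Hj andbT; case: j minj {Hj} => [|j] minj; first by rewrite expr0; lra.
  by rewrite ltNge; apply/negP => /minj; rewrite ltnn.
rewrite leqNgt; apply/negP => j4.
have : 2 ^+ j.+1 <= 2 ^+ 4 :> R by rewrite ler_weXn2l // ler1n.
have -> : 2 ^+ 4 = 16 :> R by ring.
by lra.
Qed.

(** Polarization turns the family into the single function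
    g(w) = sum conj(s_k(z)) s_k(w), whose value at [z] is the sum S to be
    bounded.  Schwarz' lemma is applied to g on the complex line through [p] and
    [z], scaled so that the parameter 2 corresponds to [z].  By the inequality
    between means |g| is at most (a S + M / a) / 2 for every a > 0, so that the
    constants do not depend on the number of functions. *)
Lemma schwarz_family (s : nat -> Cn -> R[i]) (r : seq nat) (p : Cn) (rho M : R) :
  0 < rho ->
  (forall k, k \in r -> forall z, enorm (z - p) < rho -> differentiable (s k) z) ->
  (forall k, k \in r -> s k p = 0) ->
  (forall z, enorm (z - p) < rho -> \sum_(k <- r) sqnormC (s k z) <= M) ->
  forall z, enorm (z - p) < rho / 64 ->
    \sum_(k <- r) sqnormC (s k z) <= 1024 * M / rho ^+ 2 * enorm (z - p) ^+ 2.
Proof.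
move=> rho0 sd sp sM z; set tau := enorm (z - p) => ztau.
have [tau0|tau0] := eqVneq tau 0.
  have zp : z = p by apply/eqP; rewrite -subr_eq0; apply/eqP/enorm_eq0.
  rewrite tau0 expr0n mulr0 big_seq big1 // => k kr.
  by rewrite zp sp // sqnormCE normc0 expr0n.
have {}tau0 : 0 < tau by rewrite lt0r tau0 enorm_ge0.
have [j j4 /andP[jx xj]] : exists2 j, (4 <= j)%N & 2 ^+ j < rho / tau <= 2 * 2 ^+ j.
  apply: dyadic_scale; rewrite ltr_pdivlMr //; move: ztau.
  by rewrite ltr_pdivlMr // mulrC.
set l := 2 ^+ j in jx xj.
have l0 : 0 < l by rewrite exprn_gt0.
move: jx xj; rewrite ltr_pdivlMr // ler_pdivrMr // => jx xj.
set S := \sum_(k <- r) sqnormC (s k z).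
have S0 : 0 <= S by apply: sumr_ge0 => k _; exact: sqnormC_ge0.
have M0 : 0 <= M.
  apply: le_trans (sM p _); last by rewrite subrr enorm0.
  by apply: sumr_ge0 => k _; exact: sqnormC_ge0.
pose g w := \sum_(k <- r) conjc (s k z) * s k w.
pose v := (2^-1 : R[i]) *: (z - p).
pose f (t : R[i]) := g (p + t *: v).
(* The parameter a = l / 16 makes the term in S of Schwarz' bound equal to
   S / 2, which is absorbed in the left-hand side. *)
pose A := (l / 16 * S + M / (l / 16)) / 2.
have inball t : closed_square ((- l) +i* (- l))%C (2 * l)%:C%C t ->
    enorm (p + t *: v - p) < rho.
  move=> /closed_square_centered/(_ (ltW l0)) tl.
  rewrite addrC addKr !enormZ normcV (normc_nat R 2) -/tau.
  by apply: le_lt_trans jx; rewrite mulrA ler_pM2r //; lra.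
have fA t : closed_square ((- l) +i* (- l))%C (2 * l)%:C%C t ->
    cderivable f t /\ normc (f t) <= A.
  move=> /inball tb; split.
    apply: cderivable_line; apply: differentiable_lin_comb => k kr.
    exact: sd.
  have : normc (f t) <= \sum_(k <- r)
     (l / 16 * sqnormC (s k z) + sqnormC (s k (p + t *: v)) / (l / 16)) / 2.
    rewrite /f /g; elim: (r) => [|k r' IH]; first by rewrite !big_nil normc0.
    rewrite !big_cons; apply: (le_trans (normc_triangle _ _)).
    apply: lerD => //; rewrite normcM normc_conjc !sqnormCE.
    set a := normc _; set b := normc _.
    have q : 0 < l / 16 by rewrite divr_gt0.
    rewrite -subr_ge0.
    have -> : (l / 16 * a ^+ 2 + b ^+ 2 / (l / 16)) / 2 - a * b =
        (l / 16 * a - b) ^+ 2 / (l / 16) / 2.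
      by field; rewrite lt0r_neq0.
    by rewrite !divr_ge0 ?sqr_ge0 // ltW.
  move=> /le_trans; apply; rewrite -mulr_suml big_split /= -mulr_sumr -mulr_suml.
  rewrite /A ler_wpM2r // lerD2l ler_wpM2r ?sM //.
  by rewrite invr_ge0 divr_ge0 // ltW.
have f0 : f 0 = 0.
  rewrite /f scale0r addr0 /g big_seq big1 // => k kr.
  by rewrite sp // mulr0.
have f2 : f 2%:R = S%:C%C.
  rewrite /f /v scalerA divff ?pnatr_eq0 // scale1r addrC subrK /g /S.
  rewrite (big_morph (real_complex R) (id1 := 0) (op1 := +%R)) //; last first.
    exact: (rmorphD (real_complex R)).
  by apply: eq_bigr => k _; rewrite conjc_mul_self.
have := schwarz_square j4 fA f0; rewrite f2 normc_real ger0_norm // -/l.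
rewrite ler_pdivlMr // /A.
have -> : 16 * ((l / 16 * S + M / (l / 16)) / 2) = l * S / 2 + 128 * M / l.
  by field; rewrite lt0r_neq0.
move=> h; have {}h : S * l ^+ 2 <= 256 * M.
  have : S * l / 2 <= 128 * M / l by lra.
  rewrite ler_pdivlMr // => h2.
  have -> : S * l ^+ 2 = 2 * (S * l / 2 * l) by field.
  by lra.
rewrite mulrAC ler_pdivlMr ?exprn_gt0 //.
apply: (@le_trans _ _ (S * (2 * l * tau) ^+ 2)).
  by rewrite ler_wpM2l // ler_pXn2r ?nnegrE ?mulr_ge0 //; lra.
by rewrite !exprMn; have := sqr_ge0 tau; nra.
Qed.

End SchwarzFamily.

(** * Lelong numbers and logarithmic bounds *)
Section Lelong.
Variables (R : realType) (n : nat).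
Local Notation Cn := 'rV[R[i]]_n.
Implicit Types (u : Cn -> \bar R) (p : Cn).

Lemma dnbhs_enorm p (V : set Cn) : p^' V <->
  exists2 r : R, 0 < r & forall w, enorm (w - p) < r -> w != p -> V w.
Proof.
rewrite /dnbhs /within /=; split.
  by move=> /nbhs_enorm[r r0 H]; exists r.
by move=> [r r0 H]; apply/nbhs_enorm; exists r.
Qed.

(** The constant [C] is harmless since ln (C t) <= (ln t) / 2 for small t. *)
Lemma lelong_at_gt0 u p (kappa C r : R) : 0 < kappa -> 0 < C -> 0 < r ->
  (forall w, enorm (w - p) < r -> w != p ->
    (u w <= (kappa * ln (C * enorm (w - p)))%:E)%E) ->
  (0 < lelong_at u p)%E.
Proof.
move=> k0 C0 r0 H; apply: (@lt_le_trans _ _ (kappa / 2)%:E).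
  by rewrite lte_fin divr_gt0.
rewrite /lelong_at limf_einfE.
pose r1 := Num.min r (Num.min (1 / 2) (C ^- 2)).
have r10 : 0 < r1 by rewrite !lt_min r0 invr_gt0 exprn_gt0 //= andbT divr_gt0.
apply: le_trans (ereal_sup_ubound _); last first.
  exists [set w | enorm (w - p) < r1 /\ w != p] => //.
  by apply/dnbhs_enorm; exists r1.
apply: le_ereal_inf_tmp => _ [w [wr wp] <-].
have := wr; rewrite !lt_min => /and3P[wr0 w1 wC].
have {}H := H w wr0 wp.
set t := enorm (w - p) in H wr w1 wC *.
have t0 : 0 < t by apply: enorm_gt0; rewrite subr_eq0.
have lt0 : ln t < 0 by apply: ln_lt0; lra.
have lC : 2 * ln (C * t) <= ln t.
  rewrite lnM ?posrE //.
  have : ln (C ^+ 2 * t) <= 0.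
    apply: ln_le0; move: wC; rewrite -[X in _ < X]mul1r ltr_pdivlMr ?exprn_gt0 //.
    by rewrite mulrC => /ltW.
  rewrite lnM ?posrE ?exprn_gt0 // lnXn //; rewrite mulr2n; lra.
have il : (ln t)^-1 < 0 by rewrite invr_lt0.
case: (u w) H => [v| |] //=; last by rewrite lt0_mulNye ?lte_fin // leey.
rewrite !lee_fin => vH.
rewrite ler_ndivlMr //; apply: (le_trans vH).
by nra.
Qed.

(** Dividing by the negative number ln |w - p| reverses inequalities: a lower
    bound on the quotient is an upper bound on [u]. *)
Lemma lelong_at_gt0_upper u p : (0 < lelong_at u p)%E ->
  exists gamma r : R, [/\ 0 < gamma, 0 < r, r < 1 & forall w, enorm (w - p) < r ->
    w != p -> (u w <= (gamma * ln (enorm (w - p)))%:E)%E].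
Proof.
rewrite /lelong_at limf_einfE => /ereal_sup_gt[_ [V /dnbhs_enorm[r r0 HV] <-]] I0.
have [gamma g0 gI] : exists2 gamma : R, 0 < gamma &
    (gamma%:E <= ereal_inf ((fun z => u z * ((ln (enorm (z - p)))^-1)%:E)%E @` V))%E.
  case: (ereal_inf _) I0 => [v| |] //; first by rewrite lte_fin => v0; exists v.
  by move=> _; exists 1; rewrite ?leey.
exists gamma, (Num.min r (1 / 2)); split => //.
- by rewrite lt_min r0 divr_gt0.
- by rewrite gt_min; apply/orP; right; lra.
move=> w; rewrite lt_min => /andP[wr w1] wp.
have := le_trans gI (ereal_inf_lbound (imageP _ (HV _ wr wp))).
set t := enorm (w - p) in wr w1 *.
have t0 : 0 < t by apply: enorm_gt0; rewrite subr_eq0.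
have lt0 : ln t < 0 by apply: ln_lt0; lra.
have il : (ln t)^-1 < 0 by rewrite invr_lt0.
case: (u w) => [v| |] //=; last by rewrite leNye.
  by rewrite !lee_fin ler_ndivlMr.
by rewrite lt0_mulye ?lte_fin.
Qed.

End Lelong.

(** * Charts and quasi-plurisubharmonic functions *)
Section Charts.
Variables (R : realType) (n : nat) (X : topologicalType).
Local Notation Cn := 'rV[R[i]]_n.
Implicit Types (c : chart R n X) (x : X) (z : Cn).

Lemma chart_fun_near c x (P : set Cn) : chart_dom c x ->
  (\forall z \near chart_fun c x, P z) ->
  \forall y \near x, chart_dom c y /\ P (chart_fun c y).
Proof.
move=> cx Pz; apply: filterI; first exact: (open_nbhs_nbhs (conj (chart_dom_open c) cx)).
exact: (chart_fun_cont cx Pz).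
Qed.

Lemma open_near (N : set Cn) z : open N -> N z -> \forall w \near z, N w.
Proof. by move=> oN Nz; have := open_nbhs_nbhs (conj oN Nz); exact. Qed.

Lemma chart_inv_near c z (Q : set X) : chart_img c z ->
  (\forall y \near chart_inv c z, Q y) ->
  \forall w \near z, chart_img c w /\ Q (chart_inv c w).
Proof.
move=> cz Qy; have h2 := open_near (@chart_img_open _ _ _ c) cz.
have : nbhs z (chart_inv c @^-1` Q) by exact (chart_inv_cont cz Qy).
by move=> h1; apply: filterS2 h2 h1 => w ? ?; split.
Qed.

Lemma transition_lipschitz c c' x : holomorphic_transition c c' ->
  chart_dom c x -> chart_dom c' x -> exists C r : R, [/\ 0 < C, 0 < r &
    forall z, enorm (z - chart_fun c x) < r ->
    [/\ chart_img c z, chart_dom c' (chart_inv c z) &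
      enorm (chart_fun c' (chart_inv c z) - chart_fun c' x) <=
        C * enorm (z - chart_fun c x)]].
Proof.
move=> hol cx c'x; set p := chart_fun c x.
have cp : chart_img c p by exact: chart_funP.
have xp : chart_inv c p = x by exact: chart_funK.
have [C [r [C0 r0 H]]] : exists C r : R, [/\ 0 <= C, 0 < r &
    forall w, enorm (w - p) < r -> enorm ((chart_fun c' \o chart_inv c) w -
      (chart_fun c' \o chart_inv c) p) <= C * enorm (w - p)].
  apply: differentiable_enorm_lipschitz; apply: hol; split => //=.
  by rewrite xp.
have [r2 r20 H2] : exists2 r : R, 0 < r & forall w, enorm (w - p) < r ->
    chart_img c w /\ chart_dom c' (chart_inv c w).
  apply/nbhs_enorm; apply: chart_inv_near => //; rewrite xp.
  exact: (open_nbhs_nbhs (conj (chart_dom_open c') c'x)).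
exists (C + 1), (Num.min r r2); split; [by lra|by rewrite lt_min r0|].
move=> z; rewrite lt_min => /andP[/H zr /H2[zc zc']]; split => //.
move: zr => /=; rewrite xp => /le_trans; apply.
by rewrite ler_wpM2r ?enorm_ge0 //; lra.
Qed.

Lemma smooth_on_continuous (N : set Cn) (g : Cn -> R) z : smooth_on N g -> N z ->
  {for z, continuous g}.
Proof. by move=> /(_ 0%N)[+ _] => /[apply]. Qed.

Variable M : complex_manifold R n X.

(** Upper semicontinuity and finiteness from above are topological, hence
    independent of the chart in which the decomposition is given. *)
Lemma quasi_psh_usc (W : set X) (phi : X -> \bar R) x : quasi_psh M W phi -> W x ->
  (phi x < +oo)%E /\ forall a : R, (phi x < a%:E)%E ->
    \forall y \near x, (phi y < a%:E)%E.
Proof.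
move=> /[apply] -[c [N [[_ [cx oN Nx NI _]] [u [g [pu sg phiE]]]]]].
have xE : phi x = (u (chart_fun c x) + (g (chart_fun c x))%:E)%E.
  by rewrite -phiE // chart_funK.
set z := chart_fun c x in Nx xE; have uy := psh_lty pu Nx.
split; first by rewrite xE; case: (u z) uy => //= v _; rewrite ltey.
move=> a; rewrite xE => ua.
have [b ub bg] : exists2 b : R, (u z < b%:E)%E & g z < a - b.
  case: (u z) uy ua => [v| |] //=.
    rewrite -EFinD lte_fin => _ va; exists ((v + a - g z) / 2); first by rewrite lte_fin; lra.
    by lra.
  by move=> _ _; exists (a - g z - 1); [exact: ltNyr|lra].
have uN := psh_usc pu Nx ub.
have gN : \forall w \near z, g w < a - b.
  have := smooth_on_continuous sg Nx => /cvgr_lt; exact.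
have NN : \forall w \near z, N w by exact: open_near.
have all : \forall w \near z, [/\ N w, (u w < b%:E)%E & g w < a - b].
  by apply: filterS3 NN uN gN => w ? ? ?; split.
apply: filterS (chart_fun_near cx all) => y [cy [Ny uy' gy]].
rewrite -(chart_funK cy) phiE //; case: (u _) uy' => [v| |] //=;
  last by move=> _; rewrite addNye ltNyr.
by rewrite -EFinD !lte_fin; lra.
Qed.

End Charts.

(** * Poles have a positive Lelong number *)
Section Poles.
Variables (R : realType) (n : nat).
Local Notation Cn := 'rV[R[i]]_n.

Lemma esum_le_real (K : set nat) (F : nat -> R) (M : R) :
  (forall r, uniq r -> (forall k, k \in r -> K k) -> \sum_(k <- r) F k <= M) ->
  (\esum_(k in K) (F k)%:E <= M%:E)%E.
Proof.
move=> H; apply: ge_ereal_sup => _ [A [finA AK] <-].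
rewrite fsbig_finite // sumEFin lee_fin; apply: H; first exact: finmap.fset_uniq.
by move=> k; rewrite in_fset_set // => /set_mem/AK.
Qed.

Lemma le_esum_real (K : set nat) (F : nat -> R) (r : seq nat) :
  uniq r -> (forall k, k \in r -> K k) ->
  ((\sum_(k <- r) F k)%:E <= \esum_(k in K) (F k)%:E)%E.
Proof.
move=> ur rK; apply: esum_ge; exists [set` r]; last by rewrite -fsbig_seq // sumEFin.
by split; [exact: finite_seq|move=> k /rK].
Qed.

Lemma lne_le (x : \bar R) (a : R) : (lne x <= a%:E)%E -> (x <= (expR a)%:E)%E.
Proof.
case: x => [x| |] //=; do ?by rewrite ?leNye ?leey.
case: ifPn => [x0 _|]; first by rewrite lee_fin (le_trans x0) // expR_ge0.
by rewrite -ltNge => x0; rewrite !lee_fin => h; rewrite -[x]lnK ?posrE // ler_expR.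
Qed.

Lemma lne_ge (x : \bar R) (a : R) : 0 < a -> (x <= a%:E)%E -> (lne x <= (ln a)%:E)%E.
Proof.
move=> a0; case: x => [x| |] //=; do ?by rewrite ?leNye ?leey.
case: ifPn => [x0 _|]; first by rewrite leNye.
by rewrite -ltNge => x0; rewrite !lee_fin ler_ln // posrE.
Qed.

(** The bound of [schwarz_family] is uniform over the finite subfamilies, hence
    it holds for the whole sum. *)
Lemma log_sum_upper (K : set nat) (s : nat -> Cn -> R[i]) (p : Cn) (rho M : R) :
  0 < rho ->
  (forall k, K k -> forall z, enorm (z - p) < rho -> differentiable (s k) z) ->
  (forall k, K k -> s k p = 0) ->
  (forall z, enorm (z - p) < rho ->
    (\esum_(k in K) (sqnormC (s k z))%:E <= M%:E)%E) ->
  exists C : R, 0 < C /\ forall z, enorm (z - p) < rho / 64 -> z != p ->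
    (lne (\esum_(k in K) (sqnormC (s k z))%:E) <= (2 * ln (C * enorm (z - p)))%:E)%E.
Proof.
move=> rho0 sd sp sM; pose D := 1024 * M / rho ^+ 2.
exists (Num.sqrt (`|D| + 1)); split.
  by rewrite sqrtr_gt0 ltr_wpDl.
move=> z zp zneq; have z0 : 0 < enorm (z - p) by rewrite enorm_gt0 // subr_eq0.
have C0 : 0 < Num.sqrt (`|D| + 1) by rewrite sqrtr_gt0 ltr_wpDl.
have -> : 2 * ln (Num.sqrt (`|D| + 1) * enorm (z - p)) =
    ln ((`|D| + 1) * enorm (z - p) ^+ 2).
  rewrite mulrC mulr_natr -lnXn; last by rewrite mulr_gt0.
  by rewrite exprMn sqr_sqrtr // addr_ge0.
apply: lne_ge; first by rewrite mulr_gt0 ?exprn_gt0 // ltr_wpDl.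
apply: esum_le_real => r ur rK.
have := @schwarz_family R n s r p rho M rho0 _ _ _ z zp.
move=> /(_ (fun k kr => sd k (rK k kr)) (fun k kr => sp k (rK k kr))).
move=> /(_ _)/le_trans; apply.
  move=> w wp; rewrite -lee_fin; apply: le_trans (sM w wp).
  exact: le_esum_real.
rewrite -/D ler_wpM2r ?sqr_ge0 //.
by have := ler_norm D; lra.
Qed.

End Poles.

Section PolesLelong.
Variables (R : realType) (n : nat) (X : topologicalType).
Variable M : complex_manifold R n X.
Local Notation Cn := 'rV[R[i]]_n.

(** The Lelong number is computed in the preferred chart; the change of
    coordinates only affects the constant [C]. *)
Lemma lelong_gt0_chart (u : X -> \bar R) (x : X) (c : chart R n X)
    (kappa C r : R) : holomorphic_chart M c -> chart_dom c x ->
  0 < kappa -> 0 < C -> 0 < r ->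
  (forall z, enorm (z - chart_fun c x) < r -> z != chart_fun c x ->
    (u (chart_inv c z) <= (kappa * ln (C * enorm (z - chart_fun c x)))%:E)%E) ->
  (0 < lelong M u x)%E.
Proof.
move=> hc cx k0 C0 r0 H; set p := chart_fun c x in H.
have [_ tr] := hc x; have c0x := chart_at_dom M x.
have [B [r1 [B0 r10 H1]]] := transition_lipschitz tr c0x cx.
set q := chart_fun (chart_at M x) x in H1.
apply: (@lelong_at_gt0 _ _ _ _ kappa (C * B) (Num.min r1 (r / B))) => //.
- by rewrite mulr_gt0.
- by rewrite lt_min r10 divr_gt0.
move=> w; rewrite -/q lt_min => /andP[wr1]; rewrite ltr_pdivlMr // => wr wq.
have [iw cw lip] := H1 w wr1.
set z := chart_fun c (chart_inv (chart_at M x) w) in lip.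
have zE : chart_inv c z = chart_inv (chart_at M x) w by exact: chart_funK.
have zp : z != p.
  apply: contra_neq wq => zp; rewrite -(chart_invK iw) /q; congr chart_fun.
  by rewrite -zE zp /p chart_funK.
have zr : enorm (z - p) < r by apply: le_lt_trans lip _; rewrite mulrC.
have z0 : 0 < enorm (z - p) by rewrite enorm_gt0 // subr_eq0.
have w0 : 0 < enorm (w - q) by rewrite enorm_gt0 // subr_eq0.
rewrite /= -zE; apply: (le_trans (H z zr zp)); rewrite lee_fin ler_pM2l //.
rewrite ler_ln ?posrE ?mulr_gt0 // -mulrA ler_pM2l //.
Qed.

(** Near a pole, psi_j is a positive multiple of the logarithm of the sum of the
    |sigma_k|^2 up to a bounded term, and it is bounded above, which bounds that
    sum as required by [log_sum_upper]. *)
Lemma poles_lelong (U : nat -> set X) (phi : X -> \bar R) (nu m : nat -> nat)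
    (psi : nat -> X -> \bar R) (Z : nat -> set X) (j : nat) (x : X) :
  demailly_approximation M U phi nu m psi Z -> Z j x -> (0 < lelong M phi x)%E.
Proof.
move=> D Zx; have Ux : U j x by have := Zx; rewrite (dem_poles D) => -[].
apply: lt_le_trans (dem_lelong D Ux).2.
have [c [N [pc [r0 [a [K [s [g [[hc [cx oN Nx NI NU]] [BI NB] onb sg loc]]]]]]]]] :=
  dem_local D Ux.
set p := chart_fun c x in Nx *.
have qpsi : quasi_psh M (U j) (psi j) by case: D.
have [psiy psiusc] := quasi_psh_usc qpsi Ux.
have [A psiA] : exists A : R, \forall y \near x, (psi j y < A%:E)%E.
  case: (psi j x) psiy psiusc => [v| |] //= _ H.
    by exists (v + 1); apply: H; rewrite lte_fin ltrDl.
  by exists 0; apply: H; exact: ltNyr.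
set kap := (1 + 2 ^- nu j) / (2 * (m j)%:R) in loc.
have e0 : 0 < 1 + 2 ^- nu j :> R by rewrite ltr_wpDr // invr_ge0 exprn_ge0.
have kap0 : 0 < kap.
  by rewrite divr_gt0 // mulr_gt0 // ltr0n (dem_m_gt0 D).
have gc := smooth_on_continuous sg Nx.
have gub : \forall z \near p, g z < g p + 1.
  by have /cvgr_lt := gc; apply; rewrite ltrDl.
have glb : \forall z \near p, g p - 1 < g z.
  by have /cvgr_gt := gc; apply; rewrite ltrBlDr ltrDl.
have psiA' : \forall z \near p, chart_img c z /\ (psi j (chart_inv c z) < A%:E)%E.
  apply: (@chart_inv_near _ _ _ c p (fun y => psi j y < A%:E)%E (chart_funP cx)).
  by rewrite (chart_funK cx).
have [rho rho0 Hrho] : exists2 rho : R, 0 < rho & forall z, enorm (z - p) < rho ->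
    [/\ N z, g z < g p + 1, g p - 1 < g z & (psi j (chart_inv c z) < A%:E)%E].
  apply/nbhs_enorm; have NN := open_near oN Nx.
  apply: filterS2 (filterI NN gub) (filterI glb psiA') => z [? ?] [? [_ ?]].
  by split.
have [_ loc0] := loc p Nx.
have sp k : K k -> s k p = 0.
  by apply: loc0.1; rewrite /p chart_funK.
have sd k : K k -> forall z, enorm (z - p) < rho -> differentiable (s k) z.
  move=> Kk z zp; have [hs _] := onb_mem onb Kk.
  by apply: hs; apply: NB; have [] := Hrho z zp.
pose S z := (\esum_(k in K) (sqnormC (s k z))%:E)%E.
have sM z : enorm (z - p) < rho -> (S z <= (expR ((A - (g p - 1)) / kap))%:E)%E.
  move=> zp; have [Nz _ gz pz] := Hrho z zp.
  have [psiE _] := loc z Nz; rewrite psiE -/(S z) in pz.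
  apply: lne_le; case: (lne (S z)) pz => [v| |] //=.
  - by rewrite -EFinM -EFinD lte_fin lee_fin ler_pdivlMr // => ?; lra.
  - by rewrite gt0_muley ?lte_fin.
  - by rewrite leNye.
have [C [C0 HC]] := log_sum_upper rho0 sd sp sM.
pose E := (1 + 2 ^- nu j)^-1 : R.
have E0 : 0 < E by rewrite invr_gt0.
pose C1 := C * expR ((g p + 1) / (2 * kap)).
apply: (@lelong_gt0_chart _ _ c (E * (2 * kap)) C1 (rho / 64)) => //.
- by apply: mulr_gt0 => //; apply: mulr_gt0.
- by rewrite mulr_gt0 ?expR_gt0.
- by rewrite divr_gt0.
move=> z zr zp; have zrho : enorm (z - p) < rho by apply: lt_le_trans zr _; lra.
have [Nz gz _ _] := Hrho z zrho.
have [-> _] := loc z Nz; have := HC z zr zp; rewrite -/(S z) -/p.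
have z0 : 0 < enorm (z - p) by rewrite enorm_gt0 // subr_eq0.
have -> : C1 * enorm (z - p) = expR ((g p + 1) / (2 * kap)) * (C * enorm (z - p)).
  by rewrite /C1; ring.
rewrite [ln (expR _ * _)]lnM ?posrE ?expR_gt0 ?mulr_gt0 // expRK.
case: (lne (S z)) => [v| |] //=.
  rewrite !lee_fin -/E => vC. rewrite -mulrA ler_pM2l //.
  rewrite mulrDr mulrCA divff ?mulr1; last by rewrite mulf_neq0 // lt0r_neq0.
  by nra.
by move=> _; rewrite gt0_muleNy ?lte_fin // addNye gt0_muleNy ?lte_fin // leNye.
Qed.

End PolesLelong.

(** * Lebesgue measure of the complex space *)
Section Measure.
Variables (R : realType).
Local Notation mR := (measurableTypeR R).
Local Notation mC := (mR * mR)%type.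

Definition tuple_box (T : Type) n (Q : 'I_n -> set T) : set (n.-tuple T) :=
  [set t | forall j, Q j (tnth t j)].

Lemma measurable_tuple_box d (T : measurableType d) n (Q : 'I_n -> set T) :
  (forall j, measurable (Q j)) -> measurable (tuple_box Q).
Proof.
move=> mQ; rewrite (_ : tuple_box Q = \bigcap_(j in setT) ((fun t => tnth t j) @^-1` Q j)).
  apply: fin_bigcap_measurable; first exact: finite_finset.
  move=> j _; rewrite -[X in measurable X]setTI.
  exact: measurable_tnth.
by apply/seteqP; split => [t tQ j _|t tQ j]; [exact: tQ|exact: (tQ j I)].
Qed.

Lemma tuple_measure_box d (T : measurableType d)
    (mu : {sigma_finite_measure set T -> \bar R}) n (Q : 'I_n -> set T) :
  (forall j, measurable (Q j)) ->
  tuple_measure mu n (tuple_box Q) = (\prod_(j < n) mu (Q j))%E.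
Proof.
elim: n Q => [|n IH] Q mQ.
  rewrite big_ord0 /= diracE mem_set //.
  by move=> [].
rewrite big_ord_recl -IH //= /cons_measure /pushforward.
rewrite (_ : _ @^-1` _ = Q ord0 `*` tuple_box (fun j => Q (lift ord0 j))).
  by rewrite /prod_measure product_measure1E //; apply: measurable_tuple_box.
apply/seteqP; split => [[x t] /= H|[x t] /= [Qx Qt] j].
  split; first by have := H ord0; rewrite (tnth_nth x).
  move=> j; have := H (lift ord0 j); rewrite !(tnth_nth x) /=.
  by rewrite /bump /=.
case: (unliftP ord0 j) => [i ->|->]; last by rewrite (tnth_nth x).
by have := Qt i; rewrite !(tnth_nth x).
Qed.

Variable n : nat.
Local Notation Cn := 'rV[R[i]]_n.

Definition square_at (a b e : R) : set mC :=
  (`]a - e, a + e[ : set mR)%classic `*` (`]b - e, b + e[ : set mR)%classic.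

Lemma measurable_square_at a b e : measurable (square_at a b e).
Proof. by apply: measurableX; exact: measurable_itv. Qed.

Lemma lebesgueC_square_at a b e : 0 < e ->
  lebesgueC R (square_at a b e) = (((2 * e) ^+ 2)%:E)%E.
Proof.
move=> e0; rewrite /lebesgueC /= /prod_measure product_measure1E; [|exact: measurable_itv..].
have len (x : R) : lebesgue_measure (`]x - e, x + e[ : set mR)%classic = (2 * e)%:E.
  have := lebesgue_measure_itv `]x - e, x + e[ => -> /=.
  by rewrite lte_fin ifT; [rewrite -EFinB; congr EFin; ring|lra].
by rewrite expr2 EFinM; congr (_ * _)%E; exact: len.
Qed.

Definition cube (p : Cn) (e : R) : set (n.-tuple mC) :=
  tuple_box (fun j => square_at (complex.Re (p 0 j)) (complex.Im (p 0 j)) e).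

Lemma measurable_cube p e : measurable (cube p e).
Proof. by apply: measurable_tuple_box => j; exact: measurable_square_at. Qed.

Lemma lebesgueCn_cube p e : 0 < e ->
  lebesgueCn R n (cube p e) = (((2 * e) ^+ (2 * n))%:E)%E.
Proof.
move=> e0; rewrite /lebesgueCn tuple_measure_box;
  last by move=> j; exact: measurable_square_at.
under eq_bigr do rewrite lebesgueC_square_at //.
by rewrite prodEFin big_const_ord iter_mulr_1 exprM.
Qed.

Lemma cube_normc p e t j : cube p e t -> normc ((cvec t - p) 0 j) <= 2 * e.
Proof.
move=> /(_ j)[]; rewrite !mxE /=; set x := (tnth t j).1; set y := (tnth t j).2.
case: (p 0 j) => a b /=; rewrite !in_itv /= => x1 y1.
have -> : Num.sqrt ((x - a) ^+ 2 + (y - b) ^+ 2) =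
    normc ((x - a)%:C%C + 'i%C * (y - b)%:C%C) by simpc.
apply: (le_trans (normc_le_abs _ _)).
have : `|x - a| <= e by rewrite ler_norml; lra.
have : `|y - b| <= e by rewrite ler_norml; lra.
by lra.
Qed.

(** The sigma-algebra is the product one, so an open set is exhibited as a
    countable union of cubes with rational centers. *)
Lemma open_measurable_cvec (A : set Cn) : open A ->
  measurable (@cvec R n @^-1` A).
Proof.
move=> oA.
pose I := (nat * {ffun 'I_n -> rat * rat})%type.
pose ctr (i : I) : Cn := \row_j (ratr (i.2 j).1 +i* ratr (i.2 j).2)%C.
pose rad (i : I) : R := i.1.+1%:R^-1.
pose F (i : I) := if `[< cube (ctr i) (rad i) `<=` @cvec R n @^-1` A >]
  then cube (ctr i) (rad i) else set0.
rewrite (_ : @cvec R n @^-1` A = \bigcup_i F i).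
  apply: countable_bigcupT_measurable; first exact: countableP.
  by move=> i; rewrite /F; case: ifPn => _ //; exact: measurable_cube.
apply/seteqP; split => [t At|t [i _]]; last first.
  by rewrite /F; case: ifPn => [/asboolP sub|//]; exact: sub.
have [r r0 Hr] := (nbhs_enorm (cvec t) A).1 (open_near oA At).
have [N NR] : exists N : nat, N.+1%:R^-1 < r / (4 * n.+1%:R).
  have D0 : 0 < r / (4 * n.+1%:R) by rewrite divr_gt0 // mulr_gt0.
  exists (Num.trunc (r / (4 * n.+1%:R))^-1).
  rewrite -[ltRHS]invrK ltf_pV2 ?posrE ?invr_gt0 //.
  by apply: truncnS_gt.
pose e : R := N.+1%:R^-1; have e0 : 0 < e by rewrite invr_gt0.
have ratq (x : R) : exists q : rat, x - e < ratr q < x + e.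
  have [q] := @rat_in_itvoo R (x - e) (x + e) ltac:(lra).
  by rewrite in_itv /= => H; exists q.
have [q qx] := choice ratq.
pose i : I := (N, [ffun j => (q (tnth t j).1, q (tnth t j).2)]).
have ti : cube (ctr i) (rad i) t.
  move=> j; rewrite /ctr mxE ffunE /square_at /=.
  have := qx (tnth t j).1; have := qx (tnth t j).2.
  by split; rewrite /= in_itv /= -[rad i]/e; lra.
exists i => //; rewrite /F asboolT // => t' t'i; apply: Hr.
have M0 : 0 <= 4 * e by lra.
apply: le_lt_trans (enorm_le M0 _) _ => [j|].
  have -> : (cvec t' - cvec t) 0 j = (cvec t' - ctr i) 0 j - (cvec t - ctr i) 0 j.
    by rewrite !mxE; ring.
  apply: (le_trans (normc_triangleB _ _)).
  by have := cube_normc j t'i; have := cube_normc j ti; rewrite -[rad i]/e; lra.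
move: NR; rewrite -/e ltr_pdivlMr ?mulr_gt0 // => NR.
apply: le_lt_trans NR; rewrite -natr1; have : 0 <= n%:R :> R by [].
by nra.
Qed.

Lemma usc_measurable (A : set Cn) (F : Cn -> \bar R) : open A ->
  (forall z (a : R), A z -> (F z < a%:E)%E -> \forall w \near z, (F w < a%:E)%E) ->
  measurable_fun (@cvec R n @^-1` A) (fun t => F (cvec t)).
Proof.
move=> oA usc mA; apply: (measurability _ (ErealGenInftyO.measurableE R)) => //.
move=> _ [_ [a ->] <-].
rewrite (_ : _ `&` _ = @cvec R n @^-1` (A `&` [set z | (F z < a%:E)%E])).
  apply: open_measurable_cvec; rewrite openE => z [Az Fz].
  by apply: filterI; [exact: open_near|exact: usc].
by apply/seteqP; split=> t /=; rewrite in_itv /=.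
Qed.

End Measure.

(** * Zeros of multiplier ideals are poles *)
Lemma differentiable_near_eq (K : numFieldType) (V W : normedModType K)
    (f g : V -> W) (x : V) : (\forall y \near x, f y = g y) ->
  differentiable f x -> differentiable g x.
Proof.
move=> fg df; have [dfc dfo] := (diff_locallyP x f).1 df.
have gx : g x = f x by rewrite (nbhs_singleton fg).
have dgo : g \o shift x = cst (g x) + 'd f x +o_ 0 id.
  apply/eqaddoP => e e0; move/eqaddoP/(_ e e0) : dfo.
  have fg0 : \forall y \near 0, f (y + x) = g (y + x).
    by have := near_shift 0 x (fun y => f y = g y); rewrite subr0 => <-.
  apply: filterS2 fg0 => y fgy.
  by rewrite /= !fctE /= /shift gx fgy.
have dgE : 'd g x = 'd f x :> (V -> W) by exact: diff_unique.
by apply/diff_locallyP; rewrite dgE.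
Qed.

Section MeasureTools.

(** The integral of a nonnegative function is the supremum of the integrals of
    the simple functions below it, and enlarging the domain or the function adds
    such simple functions.  This is used to compare with the weight on the whole
    ball of the Bergman space. *)
Lemma ge0_integral_mono d (T : measurableType d) (R : realType)
    (mu : {measure set T -> \bar R}) (A B : set T) (f g : T -> \bar R) :
  A `<=` B -> (forall x, A x -> (0 <= f x)%E) -> (forall x, B x -> (0 <= g x)%E) ->
  (forall x, A x -> (f x <= g x)%E) ->
  (\int[mu]_(x in A) f x <= \int[mu]_(x in B) g x)%E.
Proof.
move=> AB f0 g0 fg; rewrite (integral_mkcond A) (integral_mkcond B).
rewrite !ge0_integralTE; last first.
- by apply: erestrict_ge0.
- by apply: erestrict_ge0.
apply: ereal_sup_le => _ [h hf <-]; exists h => // x; apply: (le_trans (hf x)).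
rewrite /patch; case: ifPn => [/set_mem Ax|_]; last first.
  by case: ifPn => // /set_mem; exact: g0.
by rewrite mem_set ?fg //; exact: AB.
Qed.

Lemma measurable_expeR (R : realType) : measurable_fun [set: \bar R] (@expeR R).
Proof.
move=> mT; apply: (measurability _ (ErealGenOInfty.measurableE R)) => //.
move=> _ [_ [r ->] <-]; rewrite setTI.
have [r0|r0] := leP 0 r; last first.
  rewrite (_ : _ @^-1` _ = setT) //; apply/seteqP; split => // x _ /=.
  by rewrite in_itv /= andbT; apply: lt_le_trans (expeR_ge0 x); rewrite lte_fin.
have H x : (r%:E < expeR x)%E = (lne r%:E < x)%E.
  by rewrite -[RHS]lte_expeR lneK // in_itv /= lee_fin r0 leey.
move: (lne _) H => L H.
rewrite (_ : _ @^-1` _ = `]L, +oo[%classic); first exact: emeasurable_itv.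
by apply/seteqP; split => x /=; rewrite !in_itv /= !andbT H.
Qed.

End MeasureTools.

Section MultiplierZeros.
Variables (R : realType) (n : nat) (X : topologicalType).
Variable M : complex_manifold R n X.
Local Notation Cn := 'rV[R[i]]_n.

Lemma differentiable_normc_lipschitz (h : Cn -> R[i]) z :
  differentiable h z -> exists C r : R, [/\ 0 <= C, 0 < r &
    forall w, enorm (w - z) < r -> normc (h w - h z) <= C * enorm (w - z)].
Proof.
move=> /differentiable_lipschitz[C' [r' [C0 /realC_pos[r r0 ->] H]]].
have [C C0' C'E] : exists2 C : R, 0 <= C & C' = C%:C%C.
  by case: C' C0 {H} => u v; rewrite lecE /= => /andP[/eqP -> u0]; exists u.
exists C, r; split => // w wr; rewrite -realC_le -normE realCM -C'E.
apply: (@le_trans _ _ (C' * `|w - z|)).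
  by apply: H; apply: (le_lt_trans (norm_le_enorm _)); rewrite realC_lt.
by rewrite ler_wpM2l ?norm_le_enorm // C'E ler0c.
Qed.

Lemma normc_usc (h : Cn -> R[i]) z (a : R) :
  differentiable h z -> normc (h z) < a -> \forall w \near z, normc (h w) < a.
Proof.
move=> /differentiable_normc_lipschitz[C [r [C0 r0 H]]] ha.
apply/nbhs_enorm; exists (Num.min r ((a - normc (h z)) / (C + 1))).
  by rewrite lt_min r0 divr_gt0 ?subr_gt0 //; lra.
move=> w; rewrite lt_min => /andP[wr]; rewrite ltr_pdivlMr; last by lra.
move=> wa; have := H w wr.
have := normc_triangle (h w - h z) (h z); rewrite subrK.
have := enorm_ge0 (w - z); nra.
Qed.

Lemma measurable_sqnormC_expeR (N : set Cn) (h : Cn -> R[i]) (v : Cn -> \bar R)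
    (b : R) : open N ->
  (forall z, N z -> differentiable h z) ->
  (forall z (a : R), N z -> (v z < a%:E)%E -> \forall w \near z, (v w < a%:E)%E) ->
  measurable_fun (@cvec R n @^-1` N)
    (fun t => (sqnormC (h (cvec t)))%:E * expeR ((- 2)%:E * (b%:E * v (cvec t))))%E.
Proof.
move=> oN dh vusc; apply: emeasurable_funM.
  rewrite (_ : (fun t => _) = (fun t =>
    (normc (h (cvec t)))%:E * (normc (h (cvec t)))%:E)%E); last first.
    by apply/funext => t; rewrite sqnormCE expr2 EFinM.
  have mh : measurable_fun (@cvec R n @^-1` N) (fun t => (normc (h (cvec t)))%:E).
    apply: (@usc_measurable R n N (fun z => (normc (h z))%:E) oN) => z a Nz.
    by rewrite lte_fin; exact/normc_usc/dh.
  exact: emeasurable_funM.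
apply: (measurableT_comp (@measurable_expeR R)).
by apply: measurable_funeM; apply: measurable_funeM; exact: usc_measurable.
Qed.

Lemma sqnorm_bounded_near (p : Cn) :
  exists Q : R, forall z, enorm (z - p) < 1 -> sqnorm z <= Q.
Proof.
exists ((n%:R * (enorm p + 1)) ^+ 2) => z zp.
have -> : sqnorm z = enorm z ^+ 2 by rewrite sqr_sqrtr // sqnorm_ge0.
have P0 := enorm_ge0 p.
have e1 : enorm z <= n%:R * (enorm p + 1).
  apply: enorm_le => [|j]; first by lra.
  have := normc_triangle ((z - p) 0 j) (p 0 j).
  have := normc_le_enorm (z - p) j; have := normc_le_enorm p j.
  by rewrite !mxE subrK; lra.
by rewrite ler_pXn2r ?nnegrE ?enorm_ge0 // mulr_ge0 //; lra.
Qed.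

(** Where phi <= A, lowering the exponent from m to k <= m increases e^(-2 m phi)
    by at most a constant factor; a pole of phi makes the right-hand side
    infinite. *)
Lemma expeR_weight_le (k m : nat) (phi : \bar R) (a q A Q : R) :
  (k <= m)%N -> (0 < m)%N -> (phi < A%:E)%E -> 0 <= A -> 0 <= q <= Q ->
  (expeR ((- 2)%:E * (k%:R%:E * phi)) <=
    (expR (2 * m%:R * (`|a| * Q + A)))%:E *
    expeR ((- (2 * m%:R))%:E * (phi + (a * q)%:E)))%E.
Proof.
move=> km m0 phiA A0 qQ; have mR : 0 < m%:R :> R by rewrite ltr0n.
have kR : k%:R <= m%:R :> R by rewrite ler_nat.
have kR0 : 0 <= k%:R :> R by [].
case: phi phiA => [v| |] //= vA; last first.
  rewrite addNye [((- (2 * m%:R))%:E * _)%E]lt0_muleNy; last by rewrite lte_fin; lra.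
  by rewrite /= gt0_muley ?lte_fin ?expR_gt0 // leey.
rewrite lte_fin in vA; rewrite lee_fin -expRD ler_expR.
have h1 : a * q <= `|a| * Q.
  apply: (@le_trans _ _ (`|a| * q)); first by rewrite ler_wpM2r ?ler_norm //; lra.
  by rewrite ler_wpM2l //; lra.
have h2 : (m%:R - k%:R) * v <= m%:R * A.
  by apply: (@le_trans _ _ ((m%:R - k%:R) * A)); nra.
have h3 := ler_wpM2l (ltW mR) h1.
by nra.
Qed.

(** Outside Z_j some element of the orthonormal basis is a germ of the
    multiplier ideal that does not vanish. *)
Lemma zero_locus_poles (U : nat -> set X) (phi : X -> \bar R) (nu m : nat -> nat)
    (psi : nat -> X -> \bar R) (Z : nat -> set X) (j k : nat) (x : X) :
  quasi_psh M setT phi -> demailly_approximation M U phi nu m psi Z ->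
  U j x -> (k <= m j)%N ->
  zero_locus (multiplier_ideal M (fun y => k%:R%:E * phi y)%E) x -> Z j x.
Proof.
move=> qphi D Ux km Vx; apply: contrapT => nZ.
have [c [N [pc [r0 [a [K [s [g [[hc [cx oN Nx NI NU]] [BI NB] onb sg loc]]]]]]]]] :=
  dem_local D Ux.
set p := chart_fun c x in Nx *.
have [_ loc0] := loc p Nx.
have [k0 [Kk0 sk0]] : exists k0, K k0 /\ s k0 p <> 0.
  apply: contrapT => H; apply: nZ.
  rewrite -(chart_funK cx); apply/loc0 => k0 Kk0; apply: contrapT => sk0.
  by apply: H; exists k0.
pose f := s k0 \o chart_fun c; pose h := f \o chart_inv c.
apply: sk0; apply: (Vx f); have [hols int_s] := onb_mem onb Kk0.
have hE z : N z -> h z = s k0 z by move=> Nz; rewrite /h /f /= chart_invK //; exact: NI.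
have dh z : N z -> differentiable h z.
  move=> Nz; apply: (@differentiable_near_eq _ _ _ (s k0)); last exact/hols/NB.
  by apply: filterS (open_near oN Nz) => w Nw; rewrite hE.
have phiusc z (b : R) : chart_img c z -> (phi (chart_inv c z) < b%:E)%E ->
    \forall w \near z, (phi (chart_inv c w) < b%:E)%E.
  move=> cz zb; have [_ /(_ b zb)usc] := quasi_psh_usc qphi (I : setT (chart_inv c z)).
  have := @chart_inv_near _ _ _ c z (fun y => phi y < b%:E)%E cz usc.
  by apply: filterS => w [].
split.
  exists [set y | chart_dom c y /\ N (chart_fun c y)]; split => //.
    rewrite openE => y [cy Ny]; exact: (chart_fun_near cy (open_near oN Ny)).
  move=> y [cy Ny]; exists c, N; split; last exact: dh.
  split => //; split => // _ [z Nz <-]; split; first exact/chart_invP/NI.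
  by rewrite chart_invK //; exact: NI.
have [phiy phiusc0] := quasi_psh_usc qphi (I : setT x).
have [A A0 phiA] : exists2 A : R, 0 <= A & (phi x < A%:E)%E.
  case: (phi x) phiy => [v| |] // _; last by exists 0; rewrite // ltNyr.
  by exists (`|v| + 1); rewrite ?lte_fin ?addr_ge0 //; have := ler_norm v; lra.
have [Q HQ] := sqnorm_bounded_near p.
(* The ideal is local: integrability is only checked on a neighborhood where
   phi and |z| are bounded above. *)
pose G := [set z | [/\ N z, (phi (chart_inv c z) < A%:E)%E & enorm (z - p) < 1]].
have pG : nbhs p G.
  have h1 := open_near oN Nx.
  have h2 : \forall z \near p, (phi (chart_inv c z) < A%:E)%E.
    by apply: phiusc; [exact: chart_funP|rewrite (chart_funK cx)].
  have h3 : \forall z \near p, enorm (z - p) < 1 by apply/nbhs_enorm; exists 1.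
  by apply: filterS3 h1 h2 h3 => z ? ? ?; split.
have GN z : G° z -> G z by exact: interior_subset.
exists c, G°; split.
  split => //; split => //; first exact: open_interior.
  by move=> z /GN[Nz _ _]; exact: NI.
have mG : measurable_fun (@cvec R n @^-1` G°) (fun t => (sqnormC (h (cvec t)))%:E *
     expeR ((- 2)%:E * (k%:R%:E * phi (chart_inv c (cvec t)))))%E.
  apply: (@measurable_sqnormC_expeR G° h (fun z => phi (chart_inv c z)) k%:R).
  - exact: open_interior.
  - by move=> z /GN[Nz _ _]; exact: dh.
  - by move=> z b /GN[Nz _ _]; exact/phiusc/NI.
pose E := expR (2 * (m j)%:R * (`|a| * Q + A)) : R.
have E0 : 0 < E by exact: expR_gt0.
have EE y : (E%:E * ((E^-1)%:E * y) = y)%E.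
  by rewrite muleA -EFinM mulfV ?lt0r_neq0 // mul1e.
apply/integrableP; split; first exact: mG.
rewrite (_ : (fun t => _) = (fun t => E%:E * ((E^-1)%:E * ((sqnormC (h (cvec t)))%:E *
     expeR ((- 2)%:E * (k%:R%:E * phi (chart_inv c (cvec t))))))))%E; last first.
  apply/funext => t /=; rewrite gee0_abs; last first.
    by rewrite mule_ge0 ?expeR_ge0 // lee_fin sqnormC_ge0.
  by rewrite EE.
have mGo : measurable (@cvec R n @^-1` G°).
  by apply: open_measurable_cvec; exact: open_interior.
rewrite ge0_integralZl_EFin //; last exact: ltW.
- rewrite lte_mul_pinfty //; first by rewrite lee_fin ltW.
  apply: le_lt_trans int_s; apply: ge0_integral_mono.
  + by move=> t /GN[Nt _ _]; exact: NB.
  + move=> t _; rewrite !mule_ge0 ?expeR_ge0 // lee_fin ?sqnormC_ge0 //.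
    by rewrite invr_ge0 ltW.
  + by move=> t _; rewrite mule_ge0 ?expeR_ge0 // lee_fin sqnormC_ge0.
  move=> t /GN[Nt pt et]; rewrite hE // muleCA; apply: lee_wpmul2l.
    by rewrite lee_fin sqnormC_ge0.
  have q0 : 0 <= sqnorm (cvec t) <= Q by rewrite sqnorm_ge0 HQ.
  have := expeR_weight_le a km (dem_m_gt0 D j) pt A0 q0.
  rewrite -/E => le1.
  rewrite -(@lee_pmul2l _ E%:E) ?lte_fin //.
  by rewrite EE.
- move=> t _; rewrite !mule_ge0 ?expeR_ge0 // lee_fin ?sqnormC_ge0 //.
  by rewrite invr_ge0 ltW.
- exact: measurable_funeM.
Qed.

End MultiplierZeros.

(** * Positive Lelong numbers give zeros of multiplier ideals *)
Section NonIntegrable.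
Variables (R : realType) (n : nat).
Local Notation Cn := 'rV[R[i]]_n.

(** The cube of half side e centered at p + 2 e (1, ..., 1) avoids p and stays
    within 4 n e of it.  Its volume is (2 e)^(2 n), so that its contribution is
    at least a constant times e^(-2). *)
Lemma pole_not_integrable (N : set Cn) (F : Cn -> \bar R) (p : Cn)
    (rho eta C : R) : (0 < n)%N -> 0 < rho -> 0 < eta -> 0 < C ->
  (forall z, enorm (z - p) < rho -> N z) ->
  (forall z, enorm (z - p) < rho -> z != p ->
    ((eta / (C * enorm (z - p)) ^+ (2 * n.+1))%:E <= F z)%E) ->
  ~ integrableCn N F.
Proof.
move=> n0 rho0 eta0 C0 HN HF /integrableP[_ Foo].
have nR : 1 <= n%:R :> R by rewrite ler1n.
pose B := eta * 2 ^+ (2 * n) / (C * (4 * n%:R)) ^+ (2 * n.+1).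
have D0 : 0 < C * (4 * n%:R) by rewrite !mulr_gt0 //; lra.
have B0 : 0 < B by rewrite divr_gt0 ?exprn_gt0 // mulr_gt0 ?exprn_gt0.
pose I := fine (\int[lebesgueCn R n]_(t in @cvec R n @^-1` N) `|(F \o @cvec R n) t|)%E.
have I0 : (0 <= \int[lebesgueCn R n]_(t in @cvec R n @^-1` N) `|(F \o @cvec R n) t|)%E.
  exact: integral_ge0.
have lower (e : R) : 0 < e -> 4 * n%:R * e < rho -> B / e ^+ 2 <= I.
  move=> e0 erho.
  pose q : Cn := p + const_mx (2 * e)%:C%C.
  have cubeP t : cube q e t -> [/\ enorm (cvec t - p) <= 4 * n%:R * e & cvec t != p].
    move=> ct; split.
      rewrite (_ : 4 * n%:R * e = n%:R * (4 * e)); last by ring.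
      apply: enorm_le => [|j]; first by lra.
      have := cube_normc j ct.
      have -> : (cvec t - p) 0 j = (cvec t - q) 0 j + (2 * e)%:C%C by rewrite !mxE; ring.
      have := normc_triangle ((cvec t - q) 0 j) (2 * e)%:C%C.
      by rewrite (normc_real (2 * e)) ger0_norm; lra.
    apply/eqP => tp; have [] := ct (Ordinal n0); rewrite /q -tp !mxE /=.
    by rewrite in_itv /=; set y := tnth _ _; lra.
  pose L := eta / (C * (4 * n%:R * e)) ^+ (2 * n.+1).
  have L0 : 0 <= L by rewrite divr_ge0 ?exprn_ge0 ?mulr_ge0 //; lra.
  have BE : B / e ^+ 2 = L * (2 * e) ^+ (2 * n).
    have e2n : e ^+ (2 * n) != 0 by rewrite expf_neq0 // lt0r_neq0.
    have an : (C * (4 * n%:R)) ^+ (2 * n.+1) != 0 by rewrite expf_neq0 // lt0r_neq0.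
    have eS : e ^+ (2 * n.+1) = e ^+ 2 * e ^+ (2 * n) by rewrite mulnS exprD.
    rewrite /B /L (_ : C * (4 * n%:R * e) = C * (4 * n%:R) * e); last by ring.
    rewrite [(C * (4 * n%:R) * e) ^+ _]exprMn [(2 * e) ^+ _]exprMn eS.
    move: (e ^+ (2 * n)) (_ ^+ (2 * n.+1)) (2 ^+ (2 * n)) e2n an => x y w x0 y0.
    by field; rewrite x0 y0 lt0r_neq0.
  rewrite -lee_fin /I fineK; last by rewrite ge0_fin_numE.
  rewrite BE EFinM -(lebesgueCn_cube q e0) -integral_cst; last exact: measurable_cube.
  apply: ge0_integral_mono => //.
    by move=> t /cubeP[te _]; apply: HN; exact: le_lt_trans erho.
  move=> t /cubeP[te tp] /=; apply: le_trans (lee_abs _).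
  apply: le_trans (HF _ (le_lt_trans te erho) tp).
  have z0 : 0 < enorm (cvec t - p) by rewrite enorm_gt0 // subr_eq0.
  have c1 : 0 < C * enorm (cvec t - p) by rewrite mulr_gt0.
  have c2 : 0 < C * (4 * n%:R * e) by rewrite !mulr_gt0 //; lra.
  rewrite lee_fin /L ler_pM2l // lef_pV2 ?posrE ?exprn_gt0 //.
  by rewrite ler_pXn2r ?nnegrE ?(ltW c1) ?(ltW c2) // ler_pM2l.
(* As e <= 1, the lower bound B / e^2 is at least B / e, and this exceeds |I|
   once e <= B / (|I| + 1). *)
pose e := Num.min (rho / (4 * n%:R) / 2) (Num.min 1 (B / (`|I| + 1))).
have nn0 : 0 < 4 * n%:R :> R by lra.
have i1 : 0 < `|I| + 1 by have := normr_ge0 I; lra.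
have re0 : 0 < rho / (4 * n%:R) by exact: divr_gt0.
have e0 : 0 < e.
  by rewrite !lt_min ltr01 /=; apply/andP; split; exact: divr_gt0.
have e1 : e <= rho / (4 * n%:R) / 2 by rewrite ge_min lexx.
have e2 : e <= 1 by rewrite !ge_min lexx !orbT.
have e3 : e <= B / (`|I| + 1) by rewrite !ge_min lexx !orbT.
have erho : 4 * n%:R * e < rho.
  by move: e1; rewrite mulrAC ler_pdivlMr //; lra.
have := lower e e0 erho; rewrite ler_pdivrMr ?exprn_gt0 // => h.
move: e3; rewrite ler_pdivlMr // => e3.
have h1 : I <= `|I| by exact: ler_norm.
have h2 : e ^+ 2 <= e by rewrite expr2; nra.
have := le_trans (ler_wpM2r (sqr_ge0 e) h1) (ler_wpM2l (normr_ge0 I) h2).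
by lra.
Qed.

End NonIntegrable.

Section LelongZeros.
Variables (R : realType) (n : nat) (X : topologicalType).
Variable M : complex_manifold R n X.
Local Notation Cn := 'rV[R[i]]_n.

Lemma mholomorphic_lower_bound (W : set X) (f : X -> R[i]) x :
  mholomorphic M W f -> W x -> f x <> 0 ->
  exists2 eta : R, 0 < eta & \forall y \near x, eta <= normc (f y).
Proof.
move=> /[apply] -[c [N [[_ [cx oN Nx _ _]] hf]]] fx.
have f0 : 0 < normc (f x) by rewrite lt0r normc_ge0 andbT; apply/eqP => /eq0_normc.
exists (normc (f x) / 2); first by rewrite divr_gt0.
have [C [r [C0 r0 H]]] := differentiable_normc_lipschitz (hf _ Nx).
have : \forall w \near chart_fun c x, normc (f x) / 2 <= normc (f (chart_inv c w)).
  apply/nbhs_enorm; exists (Num.min r (normc (f x) / 2 / (C + 1))).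
    by rewrite lt_min r0 !divr_gt0 //; lra.
  move=> w; rewrite lt_min => /andP[wr]; rewrite ltr_pdivlMr; last by lra.
  move=> wf; have /= := H w wr; rewrite chart_funK // => {}H.
  have := normc_subl (f x) (f x - f (chart_inv c w)).
  rewrite subKr -[normc (f x - _)]normc_opp opprB.
  have := enorm_ge0 (w - chart_fun c x); nra.
move=> /(chart_fun_near cx); apply: filterS => y [cy]; by rewrite chart_funK.
Qed.

(** The exponent gamma is the same for all charts: this lets [k] be chosen
    before the chart in which a germ of the ideal is square integrable. *)
Lemma log_pole_near (phi : X -> \bar R) x : (0 < lelong M phi x)%E ->
  exists2 gamma : R, 0 < gamma & forall c, holomorphic_chart M c ->
  chart_dom c x -> exists C r : R, [/\ 0 < C, 0 < r & forall z,
    enorm (z - chart_fun c x) < r -> z != chart_fun c x ->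
    (phi (chart_inv c z) <= (gamma * ln (C * enorm (z - chart_fun c x)))%:E)%E].
Proof.
move=> /lelong_at_gt0_upper[gamma [r [g0 r0 _ H]]]; exists gamma => // c hc cx.
have [tr _] := hc x; have c0x := chart_at_dom M x.
have [C [r1 [C0 r10 H1]]] := transition_lipschitz tr cx c0x.
set q := chart_fun (chart_at M x) x in H H1; set p := chart_fun c x in H1 *.
exists C, (Num.min r1 (r / C)); split => //.
  by rewrite lt_min r10 divr_gt0.
move=> z; rewrite lt_min => /andP[zr1]; rewrite ltr_pdivlMr // => zr zp.
have [iz cz lip] := H1 z zr1.
set w := chart_fun (chart_at M x) (chart_inv c z) in lip.
have wE : chart_inv (chart_at M x) w = chart_inv c z by exact: chart_funK.
have wq : w != q.
  apply: contra_neq zp => wq; rewrite -(chart_invK iz) /p; congr chart_fun.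
  by rewrite -wE wq /q chart_funK.
have wr : enorm (w - q) < r by apply: le_lt_trans lip _; rewrite mulrC.
have z0 : 0 < enorm (z - p) by rewrite enorm_gt0 // subr_eq0.
have w0 : 0 < enorm (w - q) by rewrite enorm_gt0 // subr_eq0.
rewrite -wE; apply: (le_trans (H w wr wq)); rewrite lee_fin ler_pM2l //.
by rewrite ler_ln ?posrE ?mulr_gt0.
Qed.

Lemma expeR_pole_ge (k : nat) (gamma t : R) (phi : \bar R) :
  0 < t -> t < 1 -> n.+1%:R <= k%:R * gamma -> (phi <= (gamma * ln t)%:E)%E ->
  (((t ^+ (2 * n.+1))^-1)%:E <= expeR ((- 2)%:E * (k%:R%:E * phi)))%E.
Proof.
move=> t0 t1 kg; have lt0 : ln t < 0 by apply: ln_lt0; rewrite t0.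
have n0 : 0 < n.+1%:R :> R by [].
have k0 : 0 < k%:R :> R.
  rewrite lt0r ler0n andbT; apply: contraTneq kg => ->.
  by rewrite mul0r -ltNge.
have -> : (t ^+ (2 * n.+1))^-1 = expR (- 2 * (n.+1%:R * ln t)).
  rewrite mulNr expRN; congr (_^-1).
  rewrite -[in LHS](lnK t0) -expRM_natl; congr expR.
  by rewrite natrM mulrA.
case: phi => [v| |] //=.
  rewrite !lee_fin ler_expR => vg.
  have : k%:R * v <= n.+1%:R * ln t.
    apply: (@le_trans _ _ (k%:R * (gamma * ln t))); first by rewrite ler_pM2l.
    by rewrite mulrA ler_nM2r.
  by lra.
move=> _; rewrite gt0_muleNy ?lte_fin // lt0_muleNy ?leey // lte_fin oppr_lt0.
Qed.

Lemma lelong_zero_locus (phi : X -> \bar R) x : (0 < n)%N ->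
  (0 < lelong M phi x)%E ->
  exists k, zero_locus (multiplier_ideal M (fun y => k%:R%:E * phi y)%E) x.
Proof.
move=> n0 /log_pole_near[gamma g0 pole].
have [k kg] : exists k : nat, n.+1%:R <= k%:R * gamma.
  exists (Num.trunc (n.+1%:R / gamma)).+1.
  by rewrite -ler_pdivrMr // ltW // truncnS_gt.
exists k => f [[W [oW Wx hf]] [c [N [[hc [cx oN Nx NI _]] intf]]]].
apply: contrapT => fx; set p := chart_fun c x in Nx.
have [eta eta0 feta] := mholomorphic_lower_bound hf Wx fx.
have [C [r [C0 r0 Hpole]]] := pole c hc cx.
have [r1 r10 H1] : exists2 r : R, 0 < r & forall z, enorm (z - p) < r ->
    N z /\ eta <= normc (f (chart_inv c z)).
  apply/nbhs_enorm; apply: filterS2 (open_near oN Nx) (_ : \forall z \near p,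
    chart_img c z /\ eta <= normc (f (chart_inv c z))) => [z Nz [_ ?]//|].
  apply: (@chart_inv_near _ _ _ c p (fun y => eta <= normc (f y)) (chart_funP cx)).
  by rewrite (chart_funK cx).
pose rho := Num.min r (Num.min r1 C^-1).
have rho0 : 0 < rho by rewrite !lt_min r0 r10 invr_gt0.
apply: (@pole_not_integrable R n N _ p rho (eta ^+ 2) C n0 rho0 _ C0 _ _ intf).
- by rewrite exprn_gt0.
- by move=> z; rewrite !lt_min => /and3P[_ /H1[]].
move=> z; rewrite !lt_min => /and3P[zr /H1[_ fz] zC] zp.
have z0 : 0 < enorm (z - p) by rewrite enorm_gt0 // subr_eq0.
rewrite EFinM; apply: lee_pmul.
- by rewrite lee_fin sqr_ge0.
- by rewrite lee_fin invr_ge0 exprn_ge0 // mulr_ge0 // ltW.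
- by rewrite lee_fin sqnormCE ler_pXn2r ?nnegrE ?normc_ge0 // ltW.
apply: expeR_pole_ge kg (Hpole z zr zp); first by rewrite mulr_gt0.
by rewrite mulrC -ltr_pdivlMr // div1r.
Qed.

End LelongZeros.

(** * The equality of the three sets *)
Lemma exhaustive_covering_mono (X : topologicalType) (U : nat -> set X) i j :
  exhaustive_covering U -> (i <= j)%N -> U i `<=` U j.
Proof.
move=> [_ _ UU _]; elim: j => [|j IH]; first by rewrite leqn0 => /eqP ->.
rewrite leq_eqVlt => /predU1P[->//|/IH ij] x /ij Ux.
by apply: UU; exact: subset_closure.
Qed.

Unset Implicit Arguments.

Theorem proposition3p11 (R : realType) (n : nat) (n_gt0 : (0 < n)%N)
    (X : topologicalType) (M : complex_manifold R n X)
    (U : nat -> set X) (hU : exhaustive_covering U)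
    (L : line_bundle M) (h : singular_metric L)
    (nu m : nat -> nat) (psi : nat -> X -> \bar R) (Z : nat -> set X)
    (hZ : demailly_approximation M U (h_weight h) nu m psi Z) :
  \bigcup_k zero_locus (metric_multiplier_ideal h k) =
    [set x | (0 < lelong M (h_weight h) x)%E] /\
  [set x | (0 < lelong M (h_weight h) x)%E] = \bigcup_j Z j.
Proof.
set phi := h_weight h; set nupos := [set x | _].
have qphi : quasi_psh M setT phi by exact: h_weight_qpsh.
have nu_V : nupos `<=` \bigcup_k zero_locus (metric_multiplier_ideal h k).
  by move=> x /(lelong_zero_locus n_gt0)[k kx]; exists k.
have V_Z : \bigcup_k zero_locus (metric_multiplier_ideal h k) `<=` \bigcup_j Z j.
  move=> x [k _ Vx]; have [_ _ _ UT] := hU.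
  have [i _ Ui] : (\bigcup_j U j) x by rewrite UT.
  have [j0 _ mj] : \forall j \near \oo, (k <= m j)%N.
    by have /cvgnyPge := dem_m_cvg hZ; exact.
  exists (maxn i j0) => //; apply: (zero_locus_poles qphi hZ _ _ Vx).
    exact: (exhaustive_covering_mono hU (leq_maxl i j0) Ui).
  by apply: mj; exact: leq_maxr.
have Z_nu : \bigcup_j Z j `<=` nupos by move=> x [j _ Zx]; exact: poles_lelong hZ Zx.
split; apply/seteqP; split => //.
- exact: subset_trans V_Z Z_nu.
- exact: subset_trans nu_V V_Z.
Qed.
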